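(* Let $f(z)=\sum_{\lambda\in\Lambda}c_\lambda e^{\bar\lambda z}$ be an exponential sum in one complex variable, where $\Lambda\subset\mathbb{C}$ is a finite set and $c_\lambda\in\mathbb{C}$. Let $N(f,r)$ denote the number of zeros of $f$ in the disk $B_r=\{z\in\mathbb{C}:|z|\le r\}$. Then $$N(f,r)=\frac{r}{2\pi}\,l(f)+O(1),$$ where $l(f)$ denotes the semiperimeter of the Newton polygon $\Delta={\rm conv}(\Lambda)$ of $f$.
   Context: $\Lambda$ is called the spectrum of $f$, and its convex hull $\Delta={\rm conv}(\Lambda)\subset\mathbb{C}$ is called the Newton polygon of $f$. The semiperimeter is half the perimeter; if $\Delta$ degenerates to a line segment, its perimeter is taken to be twice the length of the segment, so that $l(f)$ is the length of $\Delta$.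
   Formalization: The factor r/(2π) is corrected to r/π (with l(f) the semiperimeter): for f = e^z − 1 one has l(f) = 1 but N(f,r) = r/π + O(1). Zeros are counted with multiplicity, and Λ is taken non-empty with every c_λ nonzero. *)

(* Defs.v *)
From mathcomp Require Import all_boot all_order all_algebra finmap complex.
From mathcomp Require Import all_classical all_reals all_analysis.

Set Implicit Arguments.
Unset Strict Implicit.
Unset Printing Implicit Defensive.

Import Order.TTheory GRing.Theory Num.Theory numFieldNormedType.Exports.

Local Open Scope classical_set_scope.
Local Open Scope complex_scope.
Local Open Scope convex_scope.
Local Open Scope ring_scope.

Definition cexp {R : realType} (z : R[i]) : R[i] :=
  (expR (complex.Re z) * cos (complex.Im z)) +i*
  (expR (complex.Re z) * sin (complex.Im z)).

Definition expsum {R : realType} (L : {fset R[i]}) (c : R[i] -> R[i])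
    (z : R[i]) : R[i] :=
  \sum_(l <- L) c l * cexp (l^* * z).

(* Multiplicity of [z] as a zero of [f]: 0 if [f z != 0], and +oo if all the
   complex derivatives of [f] vanish at [z]. *)
Definition vanishing_order {R : realType} (f : R[i] -> R[i]) (z : R[i])
    : \bar R :=
  ereal_sup [set k%:R%:E | k in
    [set k : nat | forall j, (j < k)%N -> derive1n j (f : R[i] -> R[i]^o) z = 0]].

(* Zeros are counted with multiplicity; the count is +oo when there are
   infinitely many of them in the disk. *)
Definition zero_count {R : realType} (f : R[i] -> R[i]) (r : R) : \bar R :=
  \esum_(z in [set z : R[i] | `|z| <= r%:C /\ f z = 0]) vanishing_order f z.

(* [Rcomplex R] is [R[i]] seen as a real vector space, with R-valued norm. *)
Definition plane (R : realType) := convex_lmodType (Rcomplex R).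

Definition newton_polygon {R : realType} (L : {fset R[i]}) : set (plane R) :=
  smallest (@convex_set R (Rcomplex R)) [set` L].

Definition extreme_point {R : realType} (D : set (plane R)) (p : plane R) :=
  D p /\ forall (x y : plane R) (t : {i01 R}), D x -> D y ->
    0 < t%:num < 1 -> p = x <| t |> y -> x = p /\ y = p.

Definition left_of {R : realType} (a b z : R[i]) :=
  0 <= complex.Im ((b - a)^* * (z - a)).

(* Sides of a convex polygon as ordered pairs of consecutive vertices, the
   polygon lying to their left. If the interior is nonempty each side occurs
   once, oriented counterclockwise; if the polygon is a segment, it occurs once
   in each direction; if it is a point, there are no sides. *)
Definition oriented_sides {R : realType} (D : set (plane R))
    : set (plane R * plane R) :=
  [set e | [/\ e.1 <> e.2, extreme_point D e.1, extreme_point D e.2 &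
               D `<=` left_of e.1 e.2]].

Definition perimeter {R : realType} (D : set (plane R)) : R :=
  \sum_(e \in oriented_sides D) `|(e.2 : Rcomplex R) - e.1|.

Definition semiperimeter {R : realType} (D : set (plane R)) : R :=
  perimeter D / 2.

(* Main.v *)
Require Import Defs.
From mathcomp Require Import all_boot all_order all_algebra finmap complex.
From mathcomp Require Import all_classical all_reals all_analysis.
From mathcomp Require Import ring lra.
Import Order.TTheory GRing.Theory Num.Theory numFieldNormedType.Exports.

(* Candidate normals to the sides are the finitely many directions in which two
   points of L have the same projection. Cut from the disc of radius rho the
   caps beyond the chords of length 2W orthogonal to these directions. On each
   arc left between two chords a single vertex v dominates the exponential sum
   f, so the argument of f changes there like Im (v^* z), up to O(1). On each
   chord f is an exponential sum of one real variable with fixed frequencies,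
   hence Re f has boundedly many zeros (Rolle and the linear differential
   equation satisfied by f) and the argument of f changes by O(1). Summing by
   parts, the total change of the argument is rho times the perimeter plus
   O(1). By the argument principle, proved by dividing f by its zeros and
   choosing a continuous argument of the quotient on the star-shaped region,
   this is 2 pi times the number of zeros in the cut disc. As discs and cut
   discs are interlaced up to a bounded change of radius, the count in discs
   follows. *)

(** Near a normal several exponentials compete, and on an arc their frequencies vary, so the arc
    satisfies no fixed differential equation. On a chord the frequencies are constant, and pushing
    the chord outwards changes only the coefficients; a bound depending on frequencies and length
    alone then serves every [rho]. For this the half-length [W] must stay fixed while [rho] grows.
    It also controls the arcs: along them each other term is at most [expR (- (W * normc (v - l)))]
    times the dominant one, up to a ratio of coefficients, so one large [W] makes [v] dominant for
    all [rho]. No integral is used: arguments are continuous real lifts, and two lifts of one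
    function have the same increment, so the lift coming from the zeros can be compared with the
    explicit lift on each arc. A candidate direction normal to no side is harmless, since the
    maximisers just before and just after it coincide. Zeros on the boundary are avoided by moving
    [rho] by less than 1. *)

Set Implicit Arguments.
Unset Strict Implicit.
Unset Printing Implicit Defensive.

Local Open Scope classical_set_scope.
Local Open Scope complex_scope.
Local Open Scope fset_scope.
Local Open Scope ring_scope.

(** * Arguments of complex numbers *)

Section ComplexPhase.
Variable R : realType.
Implicit Types (z w : R[i]) (t : R).
Local Notation normc := (@Normc.normc R).
Local Notation Re := (@complex.Re R).
Local Notation Im := (@complex.Im R).

Lemma normcE z : normc z = Num.sqrt (Re z ^+ 2 + Im z ^+ 2).
Proof. by case: z. Qed.

Lemma normc_ge0 z : 0 <= normc z.
Proof. by rewrite normcE sqrtr_ge0. Qed.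

Lemma normc_sqr z : normc z ^+ 2 = Re z ^+ 2 + Im z ^+ 2.
Proof. by rewrite normcE sqr_sqrtr // addr_ge0 // sqr_ge0. Qed.

Lemma normc_eq0 z : (normc z == 0) = (z == 0).
Proof.
apply/eqP/eqP => [/Normc.eq0_normc //|->]; exact: Normc.normc0.
Qed.

Lemma normc_gt0 z : (0 < normc z) = (z != 0).
Proof. by rewrite lt_def normc_eq0 normc_ge0 andbT. Qed.

Lemma ler_Re_normc z : `|Re z| <= normc z.
Proof.
rewrite -(@ler_pXn2r _ 2) ?nnegrE ?normc_ge0 // real_normK ?num_real //.
by rewrite normc_sqr lerDl sqr_ge0.
Qed.

Lemma ler_Im_normc z : `|Im z| <= normc z.
Proof.
rewrite -(@ler_pXn2r _ 2) ?nnegrE ?normc_ge0 // real_normK ?num_real //.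
by rewrite normc_sqr lerDr sqr_ge0.
Qed.

Lemma ReD z w : Re (z + w) = Re z + Re w. Proof. by case: z w => ? ? [? ?]. Qed.
Lemma ImD z w : Im (z + w) = Im z + Im w. Proof. by case: z w => ? ? [? ?]. Qed.
Lemma ReN z : Re (- z) = - Re z. Proof. by case: z. Qed.
Lemma ImN z : Im (- z) = - Im z. Proof. by case: z. Qed.
Lemma ReM z w : Re (z * w) = Re z * Re w - Im z * Im w.
Proof. by case: z w => ? ? [? ?]. Qed.
Lemma ImM z w : Im (z * w) = Re z * Im w + Im z * Re w.
Proof. by case: z w => ? ? [? ?]. Qed.
Lemma ReV z : Re z^-1 = Re z / (Re z ^+ 2 + Im z ^+ 2).
Proof. by case: z. Qed.
Lemma ImV z : Im z^-1 = - (Im z / (Re z ^+ 2 + Im z ^+ 2)).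
Proof. by case: z. Qed.
Lemma eqC z w : Re z = Re w -> Im z = Im w -> z = w.
Proof. by case: z w => ? ? [? ?] /= -> ->. Qed.

Lemma ler_normc_ReIm z : normc z <= `|Re z| + `|Im z|.
Proof.
rewrite -(@ler_pXn2r _ 2) ?nnegrE ?normc_ge0 ?addr_ge0 // normc_sqr.
rewrite sqrrD !real_normK ?num_real // -addrA lerD2l lerDr.
by rewrite mulrn_wge0 // mulr_ge0.
Qed.

Lemma ler_normc_sum (I : Type) (s : seq I) (P : pred I) (F : I -> R[i]) :
  normc (\sum_(i <- s | P i) F i) <= \sum_(i <- s | P i) normc (F i).
Proof.
elim/big_ind2: _ => // [|x1 x2 y1 y2 h1 h2]; first by rewrite Normc.normc0.
by rewrite (le_trans (le_normcD _ _)) // lerD.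
Qed.

Definition cis t : R[i] := cos t +i* sin t.

Lemma cisD a b : cis (a + b) = cis a * cis b.
Proof.
by apply: eqC; rewrite ?ReM ?ImM /= ?cosD ?sinD // [RHS]addrC.
Qed.

Lemma cis0 : cis 0 = 1.
Proof. by rewrite /cis cos0 sin0. Qed.

Lemma normc_cis t : normc (cis t) = 1.
Proof. by rewrite normcE /= cos2Dsin2 sqrtr1. Qed.

Lemma cis2pi t : cis (t + pi *+ 2) = cis t.
Proof. by rewrite /cis cosD2pi sinD2pi. Qed.

(* [ph w t]: [t] is an argument of the nonzero number [w]. *)
Definition ph w t := exists2 r : R, 0 < r & w = r%:C * cis t.

Lemma ph_neq0 w t : ph w t -> w != 0.
Proof.
case=> r r0 ->; rewrite -normc_eq0 Normc.normcM normc_cis mulr1.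
by rewrite normcE /= expr0n addr0 sqrtr_sqr normr_eq0 gt_eqF.
Qed.

Lemma ph_normc w t : w = (normc w)%:C * cis t -> w != 0 -> ph w t.
Proof. by move=> e w0; exists (normc w) => //; rewrite normc_gt0. Qed.

Lemma phM w1 w2 a b : ph w1 a -> ph w2 b -> ph (w1 * w2) (a + b).
Proof.
move=> [r r0 ->] [s s0 ->]; exists (r * s); first exact: mulr_gt0.
by rewrite cisD rmorphM /= mulrACA.
Qed.

Lemma ph1 : ph 1 0.
Proof. by exists 1 => //; rewrite cis0 mulr1. Qed.

Lemma phX w a n : ph w a -> ph (w ^+ n) (a *+ n).
Proof.
move=> wa; elim: n => [|n IH]; first by rewrite mulr0n expr0; exact: ph1.
by rewrite exprS mulrS; exact: phM.
Qed.

Lemma ph_prod (I : eqType) (s : seq I) (F : I -> R[i]) (G : I -> R) :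
  (forall i, i \in s -> ph (F i) (G i)) ->
  ph (\prod_(i <- s) F i) (\sum_(i <- s) G i).
Proof.
elim: s => [|i s IH] H; first by rewrite !big_nil; exact: ph1.
rewrite !big_cons; apply: phM; first by apply: H; rewrite mem_head.
by apply: IH => j js; apply: H; rewrite in_cons js orbT.
Qed.

Lemma ph_uniq w a b : ph w a -> ph w b -> cis a = cis b.
Proof.
move=> [r r0 ->] [s s0] e.
have rs : r = s.
  have := congr1 normc e; rewrite !Normc.normcM !normc_cis !mulr1 !normcE /=.
  by rewrite !expr0n /= !addr0 !sqrtr_sqr !gtr0_norm.
move: e; rewrite rs => /mulfI; apply.
by rewrite eq_complex /= gt_eqF.
Qed.

Lemma ph_cexp z : ph (cexp z) (Im z).
Proof.
exists (expR (Re z)); first exact: expR_gt0.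
by apply: eqC; rewrite ?ReM ?ImM /= ?mul0r ?subr0 ?addr0.
Qed.

Definition slit w := 0 < normc w + Re w.

(** Half-angle formula: the quotient is the tangent of half the principal argument. One formula
    covers the whole slit plane, which makes continuity immediate. *)
Definition parg w : R := 2 * atan (Im w / (normc w + Re w)).

Lemma parg_bound w : `|parg w| < pi.
Proof.
have := atan_gtNpi2 (Im w / (normc w + Re w)).
have := atan_ltpi2 (Im w / (normc w + Re w)).
by rewrite ltr_norml /parg; set x := atan _; set p := pi; lra.
Qed.

Lemma slit_neq0 w : slit w -> w != 0.
Proof.
by apply: contraTneq => ->; rewrite /slit Normc.normc0 add0r ltxx.
Qed.

Lemma slitP w : (slit w) = ~~ ((Im w == 0) && (Re w <= 0)).
Proof.
rewrite /slit; apply/idP/idP.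
  apply: contraTN => /andP[/eqP i0 r0].
  by rewrite normcE i0 expr0n addr0 sqrtr_sqr ler0_norm // addNr ltxx.
move=> h; have [r0|r0] := ltP 0 (Re w).
  by rewrite ltr_wpDl // normc_ge0.
have i0 : Im w != 0 by move: h; rewrite r0 andbT.
rewrite -ltrBlDr sub0r -(@ltr_pXn2r _ 2) ?nnegrE ?oppr_ge0 ?normc_ge0 //.
by rewrite sqrrN normc_sqr ltrDl exprn_even_gt0.
Qed.

Lemma ph_parg w : slit w -> ph w (parg w).
Proof.
move=> sw; apply: ph_normc; last exact: slit_neq0.
have n2 := normc_sqr w.
set n := normc w in sw n2 *; set x := Re w in sw n2 *; set y := Im w in n2 *.
rewrite /slit -/n -/x in sw.
have n0 : 0 < n by rewrite normc_gt0 slit_neq0.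
have nx0 : n + x != 0 by rewrite gt_eqF.
have ct := cos_atan (y / (n + x)).
have tt : tan (atan (y / (n + x))) = y / (n + x) by rewrite atanK.
have c0 : 0 < cos (atan (y / (n + x))).
  by apply: cos_gt0_pihalf; rewrite atan_gtNpi2 atan_ltpi2.
have st : sin (atan (y / (n + x))) = y / (n + x) * cos (atan (y / (n + x))).
  by move: tt; rewrite /tan => {2}<-; rewrite divfK // gt_eqF.
(* [cos u ^+ 2 = (1 + cos (2 u)) / 2] for the half-angle [u]; the double-angle formulas then reduce
   to field identities. *)
have c2 : cos (atan (y / (n + x))) ^+ 2 = (n + x) / (2 * n).
  rewrite ct exprVn sqr_sqrtr; last by rewrite addr_ge0 // sqr_ge0.
  have -> : 1 + (y / (n + x)) ^+ 2 = 2 * n / (n + x).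
    have -> : (y / (n + x)) ^+ 2 = (n ^+ 2 - x ^+ 2) / (n + x) ^+ 2.
      by rewrite exprMn exprVn; congr (_ / _); rewrite n2; ring.
    by field.
  by rewrite invf_div.
have n0' : n != 0 by rewrite gt_eqF.
apply: eqC; rewrite ?ReM ?ImM /= mul0r ?subr0 ?addr0 /parg -/n -/x -/y.
- rewrite [2 * _]mulrC mulr_natr cos_mulr2n c2 -mulr_natr; field.
  exact: n0'.
- rewrite [2 * _]mulrC mulr_natr sin_mulr2n st mulrCA -expr2 c2 -mulr_natr.
  by field; rewrite nx0 n0'.
Qed.

Lemma ph_exists_pi (w : R[i]) : w != 0 -> exists t, ph w t /\ `|t| <= pi.
Proof.
move=> w0; have [sw|] := boolP (slit w).
  by exists (parg w); split; [exact: ph_parg|exact/ltW/parg_bound].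
rewrite slitP negbK => /andP[/eqP i0 r0]; exists pi.
split; last by rewrite ger0_norm // pi_ge0.
exists (- Re w).
  rewrite oppr_gt0 lt_neqAle r0 andbT; apply: contraNneq w0 => re0.
  by apply/eqP/eqC.
by apply: eqC; rewrite ?ReM ?ImM /= cospi sinpi; lra.
Qed.

Lemma slit_near1 w : normc (w - 1) < 1 -> slit w.
Proof.
move=> h; rewrite slitP; apply/nandP; right; rewrite -ltNge.
have := le_lt_trans (ler_Re_normc (w - 1)) h.
by rewrite ReD /= ltr_norml => /andP[]; lra.
Qed.

End ComplexPhase.

(** * Continuous lifts of the argument along an interval *)

Section RealLifts.
Variable R : realType.
Implicit Types (a b h x : R) (th : R -> R).

(** The limit is two-sided even at the end points, so restriction to a subinterval is free. *)
Definition cont_on a b th := forall x, a <= x <= b -> th y @[y --> x] --> th x.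

Lemma cont_on_within a b th : cont_on a b th -> {within `[a, b], continuous th}.
Proof.
move=> H; apply/continuous_in_subspaceT => x; rewrite inE /= in_itv /=; exact: H.
Qed.

Lemma cont_on_sub a b c d th : a <= c -> d <= b -> cont_on a b th -> cont_on c d th.
Proof.
move=> ac db H x /andP[cx xd]; apply: H.
by rewrite (le_trans ac cx) (le_trans xd db).
Qed.

Lemma cis_eq1_small (x y : R) : 0 <= y <= pi -> cis (x + y) = cis x -> y = 0.
Proof.
move=> /andP[y0 yp] e; have {}e : cis y = 1.
  apply: (@mulfI _ (cis x)); first by rewrite -normc_eq0 normc_cis oner_eq0.
  by rewrite mulr1 -cisD.
have cy : cos y = cos 0 by rewrite cos0; move: e => /(congr1 (@complex.Re R)).
by apply: cos_inj cy; rewrite in_itv /= ?y0 ?yp // lexx pi_ge0.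
Qed.

Lemma cont_cis_cst a b th : a <= b -> cont_on a b th ->
  (forall x, a <= x <= b -> cis (th x) = 1) -> th a <= th b.
Proof.
move=> ab cth H; rewrite leNgt; apply/negP => lt.
(* A decrease would force, by the intermediate value theorem, the value [th b + y] with
   [0 < y <= pi], where [cis] cannot be 1 again. *)
pose y := Num.min (th a - th b) pi.
have y0 : 0 < y by rewrite lt_min subr_gt0 lt pi_gt0.
have yp : y <= pi by rewrite /y ge_min lexx orbT.
have yb : th b + y <= th a by rewrite -lerBrDl /y ge_min lexx.
have [] := @IVT _ th a b (th b + y) ab (cont_on_within cth).
  have -> : Num.min (th a) (th b) = th b by apply/min_idPr/ltW.
  have -> : Num.max (th a) (th b) = th a by apply/max_idPl/ltW.
  by rewrite yb lerDl ltW.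
move=> c; rewrite in_itv /= => cab e.
have := @cis_eq1_small (th b) y; rewrite (ltW y0) yp -e !H ?lexx ?ab //.
by move=> /(_ isT erefl) y00; rewrite y00 ltxx in y0.
Qed.

(* The difference of two lifts is continuous with values in [2 pi Z]. *)
Lemma lift_unique a b th1 th2 : a <= b -> cont_on a b th1 -> cont_on a b th2 ->
  (forall x, a <= x <= b -> cis (th1 x) = cis (th2 x)) ->
  th1 b - th1 a = th2 b - th2 a.
Proof.
move=> ab c1 c2 H.
have hc (f g : R -> R) : cont_on a b f -> cont_on a b g ->
  (forall x, a <= x <= b -> cis (f x) = cis (g x)) -> f a - g a <= f b - g b.
  move=> cf cg e; apply: (@cont_cis_cst a b (fun x => f x - g x)) => //.
    by move=> x xab; apply: cvgB; [exact: cf|exact: cg].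
  by move=> x xab; rewrite cisD e // -cisD subrr cis0.
have h1 := hc _ _ c1 c2 H.
have h2 := hc _ _ c2 c1 (fun x xab => esym (H x xab)).
by apply/eqP; rewrite eq_le; lra.
Qed.

Lemma IVT_le a b th y : a <= b -> cont_on a b th -> th a <= y <= th b ->
  exists2 c, a <= c <= b & th c = y.
Proof.
move=> ab cth /andP[ay yb].
have [|c] := @IVT _ th a b y ab (cont_on_within cth).
  by rewrite ge_min le_max ay yb orbT.
by rewrite in_itv /=; exists c.
Qed.

(** The levels [y0], [y0 + pi], ... are zeros of the cosine; each is reached to the right of the
    previous one. The bound [y0 <= th x] is carried along to keep the points distinct. *)
Lemma lift_zeros a b th (m : nat) (y0 : R) : a <= b -> cont_on a b th ->
  th a <= y0 -> cos y0 = 0 -> y0 + pi *+ m <= th b ->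
  exists s : seq R, [/\ sorted <%R s, size s = m.+1 &
    forall x, x \in s -> [/\ a <= x <= b, y0 <= th x & cos (th x) = 0]].
Proof.
elim: m a y0 => [|m IH] a y0 ab cth ay cy yb.
  have [|c /andP[ac cb] cy0] := @IVT_le a b th y0 ab cth.
    by rewrite ay (le_trans _ yb) // mulr0n addr0.
  exists [:: c]; split => // x; rewrite inE => /eqP ->.
  by rewrite ac cb cy0 lexx.
have [|c /andP[ac cb] cy0] := @IVT_le a b th y0 ab cth.
  by rewrite ay (le_trans _ yb) // lerDl mulrn_wge0 // pi_ge0.
have [||||s [ss sm sP]] := IH c (y0 + pi) cb.
- exact: cont_on_sub cth.
- by rewrite cy0 lerDl pi_ge0.
- by rewrite cosDpi cy oppr0.
- by rewrite -addrA -mulrS.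
exists (c :: s); split => /=; last 1 first.
- move=> x; rewrite inE => /orP[/eqP ->|/sP [/andP[cx xb] yx ->]].
    by rewrite ac cb cy0 lexx.
  rewrite (le_trans ac cx) xb; split => //.
  by apply: le_trans yx; rewrite lerDl pi_ge0.
- rewrite path_min_sorted //; apply/allP => x /sP [/andP[cx _] yx _].
  rewrite /= lt_neqAle cx andbT; apply: contraTneq yx => <-.
  by rewrite cy0 -ltNge ltrDl pi_gt0.
- by rewrite sm.
Qed.

Lemma exists_cos0 (y : R) : exists2 d : R, 0 <= d <= pi & cos (y + d) = 0.
Proof.
have [||d] := @IVT _ (fun d => cos (y + d)) 0 pi 0 (@pi_ge0 R).
- apply: continuous_subspaceT => x; apply: continuous_comp.
    by apply: cvgD; [exact: cvg_cst|exact: cvg_id].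
  exact: continuous_cos.
- rewrite addr0 cosDpi ge_min le_max oppr_le0 oppr_ge0.
  by have /orP[] := le_total 0 (cos y) => ->; rewrite ?orbT.
by rewrite in_itv /=; exists d.
Qed.

(** A rise above [pi *+ n.+1] spends at most [pi] to reach a first zero of the cosine and then meets
    [n] further ones. A fall is a rise of [- th]. *)
Lemma lift_change_le a b th (n : nat) : a <= b -> cont_on a b th ->
  (forall s : seq R, sorted <%R s ->
     (forall x, x \in s -> a <= x <= b /\ cos (th x) = 0) -> (size s <= n)%N) ->
  `|th b - th a| <= pi *+ n.+1.
Proof.
have main (f : R -> R) : a <= b -> cont_on a b f ->
  (forall s : seq R, sorted <%R s ->
     (forall x, x \in s -> a <= x <= b /\ cos (f x) = 0) -> (size s <= n)%N) ->
  f b - f a <= pi *+ n.+1.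
  move=> ab cf H; rewrite leNgt; apply/negP => lt.
  have [d /andP[d0 dp] cd] := exists_cos0 (f a).
  have [|||s [ss sn sP]] := @lift_zeros a b f n (f a + d) ab cf.
  - by rewrite lerDl.
  - by [].
  - by move: lt; rewrite mulrS; set p := pi *+ n; lra.
  suff : (size s <= n)%N by rewrite sn ltnn.
  by apply: H => // x /sP [].
move=> ab cth H; rewrite ler_norml; apply/andP; split; last exact: main.
rewrite lerNl opprB.
have := @main (fun x => - th x) ab; rewrite opprK addrC; apply.
  by move=> x xab; apply: cvgN; exact: cth.
move=> s ss sP; apply: H => // x /sP [xab]; rewrite cosN => c0.
by split.
Qed.

End RealLifts.

(** * Zeros of solutions of linear differential inequalities *)

Section RolleZeros.
Variable R : realType.
Implicit Types (a b h x : R).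

Lemma Rolle_sorted (F F' : R -> R) x0 (s : seq R) b :
  (forall x, is_derive x 1 F (F' x)) -> path <%R x0 s ->
  (forall x, x \in x0 :: s -> F x = 0 /\ x <= b) ->
  exists s', [/\ sorted <%R s', size s' = size s &
    forall x, x \in s' -> [/\ x0 < x, x <= b & F' x = 0]].
Proof.
move=> dF; elim: s x0 => [|x1 s IH] x0 /=; first by exists [::].
move=> /andP[x01 ps] H.
have [|s' [ss' szs' s'P]] := IH x1 ps.
  by move=> x xs; apply: H; rewrite in_cons xs orbT.
have [||||c cx Dc] := @Rolle _ F x0 x1.
- by [].
- by move=> x _; have := dF x => -[].
- apply: continuous_subspaceT => x; apply: differentiable_continuous.
  by apply/derivable1_diffP; have := dF x => -[].
- by have [-> _] := H x0 (mem_head _ _); have [|-> _] := H x1;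
    rewrite ?inE ?eqxx ?orbT.
have F'c : F' c = 0 by have [_ <-] := dF c; case: Dc.
have x1b : x1 <= b by have [|] := H x1; rewrite ?inE ?eqxx ?orbT.
move: cx; rewrite in_itv /= => /andP[xc cx].
exists (c :: s'); split => /=.
- rewrite path_min_sorted //; apply/allP => x /s'P [x1x _ _] /=.
  exact: lt_trans cx x1x.
- by rewrite szs'.
- move=> x; rewrite inE => /orP[/eqP ->|/s'P [x1x xb ->]].
    by rewrite xc F'c (le_trans (ltW cx)).
  by rewrite (lt_trans x01).
Qed.

Variable F : nat -> R -> R.
Hypothesis dF : forall k x, is_derive x 1 (F k) (F k.+1 x).

Lemma chain_continuous k : continuous (F k).
Proof.
move=> x; apply: differentiable_continuous.
by apply/derivable1_diffP; have := dF k x => -[].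
Qed.

Lemma chain_zeros a b (n k : nat) (s : seq R) : (0 < n)%N ->
  sorted <%R s -> size s = (n + k)%N ->
  (forall x, x \in s -> a <= x <= b /\ F 0 x = 0) ->
  exists s', [/\ sorted <%R s', size s' = n &
    forall x, x \in s' -> a <= x <= b /\ F k x = 0].
Proof.
move=> n0; elim: k n n0 => [|k IH] n n0 ss sn sP.
  by exists s; split => //; rewrite sn addn0.
have [||s1 [ss1 sz1 s1P]] := IH n.+1 isT ss; rewrite ?sn ?addnS ?addSn //.
case: s1 ss1 sz1 s1P => [//|x0 s1] /= ss1 [sz1] s1P.
have [|s' [ss' szs' s'P]] := @Rolle_sorted _ _ x0 s1 b (dF k) ss1.
  by move=> x /s1P [/andP[_ ->] ->].
exists s'; split => //; first by rewrite szs'.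
move=> x /s'P [x0x xb ->]; rewrite xb andbT; split => //.
by have [/andP[ax0 _] _] := s1P x0 (mem_head _ _); rewrite (le_trans ax0) // ltW.
Qed.

(* If [F 0] had [n] zeros on a short interval, then each [F k] with [k < n]
   would vanish somewhere, so the mean value theorem bounds it by [b - a] times
   the maximum of [F n]; the differential inequality then forces this maximum
   to be 0. *)
Lemma short_interval_zeros a b (n : nat) (K : nat -> R) (s : seq R) :
  a <= b -> b - a <= 1 -> (forall k, 0 <= K k) ->
  (b - a) * \sum_(k < n) K k < 1 ->
  (forall x, `|F n x| <= \sum_(k < n) K k * `|F k x|) ->
  (0 < n)%N -> sorted <%R s -> size s = n ->
  (forall x, x \in s -> a <= x <= b /\ F 0 x = 0) ->
  forall x, a <= x <= b -> F 0 x = 0.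
Proof.
move=> ab h1 K0 hK Fn n0 ss sn sP.
have h0 : 0 <= b - a by rewrite subr_ge0.
have [c cab cmax] : exists2 c, c \in `[a, b] &
    forall t, t \in `[a, b] -> `|F n t| <= `|F n c|.
  apply: EVT_max => //; apply: continuous_subspaceT => x.
  by apply: continuous_comp; [exact: chain_continuous|exact: norm_continuous].
set M := `|F n c| in cmax.
have zk k : (k < n)%N -> exists2 z, a <= z <= b & F k z = 0.
  move=> kn; have [||s' [_ sz s'P]] := @chain_zeros a b (n - k) k s _ ss _ sP.
  - by rewrite subn_gt0.
  - by rewrite sn subnK // ltnW.
  case: s' sz s'P => [sz|z s' _ s'P]; first by move: kn; rewrite -subn_gt0 -sz.
  by exists z; have [] := s'P z (mem_head _ _).
have step k (B : R) : (k < n)%N ->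
    (forall x, a <= x <= b -> `|F k.+1 x| <= B) ->
    forall x, a <= x <= b -> `|F k x| <= (b - a) * B.
  move=> kn HB x /andP[ax xb]; have [z /andP[az zb] Fz] := zk k kn.
  have B0 : 0 <= B by rewrite (le_trans _ (HB x _)) // ax xb.
  have cW u v : {within `[u, v], continuous F k}.
    by apply: continuous_subspaceT; exact: chain_continuous.
  have [xz|zx] := leP x z.
    have [||y yx e] := @MVT_segment _ (F k) (F k.+1) x z => //.
    move: yx; rewrite in_itv /= => /andP[xy yz].
    move: e; rewrite Fz sub0r => /(congr1 (fun u => `|u|)).
    rewrite normrN normrM => ->; rewrite mulrC ler_pM //.
      by rewrite ger0_norm ?subr_ge0 // lerB.
    by apply: HB; rewrite (le_trans ax xy) (le_trans yz zb).
  have [||y yx e] := @MVT_segment _ (F k) (F k.+1) z x => //; first exact: ltW.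
  move: yx; rewrite in_itv /= => /andP[zy yx].
  move: e; rewrite Fz subr0 => /(congr1 (fun u => `|u|)).
  rewrite normrM => ->; rewrite mulrC ler_pM //.
    by rewrite ger0_norm ?subr_ge0 ?(ltW zx) // lerB.
  by apply: HB; rewrite (le_trans az zy) (le_trans yx xb).
have low k : (k < n)%N -> forall x, a <= x <= b -> `|F k x| <= (b - a) * M.
  move=> kn; have [j ->] : exists j, k = (n - j.+1)%N.
    by exists (n - k.+1)%N; rewrite subnSK // subKn // ltnW.
  (* Descending induction from [k = n - 1]: each step down gains a factor [b - a <= 1]. *)
  elim: j {k kn} => [|j IH].
    apply: step; first by rewrite subn1 prednK.
    by rewrite subn1 prednK // => x xab; apply: cmax; rewrite in_itv.
  (* Truncated subtraction: once [j.+1] reaches [n], both indices are 0 and nothing changes. *)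
  have [jn|nj] := leqP n j.+1.
    have e1 : (n - j.+1 = 0)%N by apply/eqP; rewrite subn_eq0.
    have e2 : (n - j.+2 = 0)%N by apply/eqP; rewrite subn_eq0 leqW.
    by move: IH; rewrite e1 e2.
  move=> x xab; apply: le_trans (_ : (b - a) * ((b - a) * M) <= _).
    apply: step => //; first by rewrite ltn_subrL.
    by rewrite subnSK.
  by rewrite ler_piMl // mulr_ge0 // /M normr_ge0.
have M0 : M = 0.
  apply/eqP; rewrite eq_le normr_ge0 andbT leNgt; apply/negP => M0.
  have : M <= \sum_(k < n) K k * ((b - a) * M).
    apply: le_trans (Fn c) _; apply: ler_sum => k _; apply: ler_wpM2l => //.
    by apply: low => //; move: cab; rewrite in_itv.
  rewrite -mulr_suml mulrA [_ * (b - a)]mulrC leNgt => /negP; apply.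
  by rewrite gtr_pMl.
move=> x xab; apply/eqP; rewrite -normr_eq0 eq_le normr_ge0 andbT.
by rewrite (le_trans (low 0%N n0 x xab)) // M0 mulr0.
Qed.

End RolleZeros.

(** * Argument of an exponential sum along a real segment *)

Section SegmentSums.
Variable R : realType.
Local Notation normc := (@Normc.normc R).
Local Notation Re := (@complex.Re R).
Local Notation Im := (@complex.Im R).

Lemma is_derive_Re_cexp (w m : R[i]) (x : R) :
  is_derive x 1 (fun y => Re (w * cexp (m * y%:C)))
    (Re (w * m * cexp (m * x%:C))).
Proof.
have -> : (fun y => Re (w * cexp (m * y%:C))) =
  (fun y => expR (Re m * y) * (Re w * cos (Im m * y) - Im w * sin (Im m * y))).
  apply/funext => y; rewrite ReM /cexp /= !ReM !ImM /= !mulr0 subr0 add0r; ring.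
have d1 (k : R) : is_derive x 1 (fun y => k * y) k.
  by apply: is_derive_eq; rewrite scaler1.
have de := is_derive1_comp (is_derive_expR (Re m * x)) (d1 (Re m)).
have dc := is_derive1_comp (is_derive_cos (Im m * x)) (d1 (Im m)).
have ds := is_derive1_comp (is_derive_sin (Im m * x)) (d1 (Im m)).
have dg := is_deriveB (is_deriveZ (Re w) dc) (is_deriveZ (Im w) ds).
apply: (is_derive_eq (is_deriveM de dg)).
rewrite -[((_ \*: _) - _) x]/(Re w * cos (Im m * x) - Im w * sin (Im m * x)).
rewrite /= /cexp /= !ReM !ImM /= !mulr0 subr0 add0r /GRing.scale /=; ring.
Qed.

Lemma normc_real (r : R) : normc r%:C = `|r|.
Proof. by rewrite normcE /= expr0n addr0 sqrtr_sqr. Qed.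

Variables (I : eqType) (s : seq I) (mu : I -> R[i]).

Let F (C : I -> R[i]) k (x : R) :=
  Re (\sum_(i <- s) C i * mu i ^+ k * cexp (mu i * x%:C)).

Lemma is_derive_Re_sum_cexp C k (x : R) : is_derive x 1 (F C k) (F C k.+1 x).
Proof.
rewrite /F; elim: s => [|i t IH].
  have -> : (fun y : R => Re (\sum_(i <- [::]) C i * mu i ^+ k * cexp (mu i * y%:C)))
    = cst 0 by apply/funext => y; rewrite big_nil.
  by rewrite big_nil; exact: is_derive_cst.
have -> : (fun y : R => Re (\sum_(j <- i :: t) C j * mu j ^+ k * cexp (mu j * y%:C)))
  = (fun y : R => Re (C i * mu i ^+ k * cexp (mu i * y%:C))) +
  (fun y : R => Re (\sum_(j <- t) C j * mu j ^+ k * cexp (mu j * y%:C))).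
  by apply/funext => y; rewrite big_cons ReD.
rewrite big_cons ReD; apply: is_deriveD.
by rewrite exprSr mulrA; exact: is_derive_Re_cexp.
Qed.

(** Characteristic polynomial of a linear differential equation satisfied by every [F C 0], whatever
    [C]. Taking real parts brings in the exponentials with conjugate frequencies, hence the second
    factor. *)
Let q : {poly R[i]} :=
  \prod_(i <- s) (('X - (mu i)%:P) * ('X - ((mu i)^*)%C%:P)).

Let q_monic : q \is monic.
Proof. by apply: monic_prod => i _; rewrite monicMl ?monicXsubC. Qed.

Let q_root i : i \in s -> q.[mu i] = 0 /\ q.[(mu i)^*%C] = 0.
Proof.
move=> si; rewrite /q (big_rem _ si) /= !hornerM !hornerXsubC !subrr.
by rewrite mul0r mulr0 !mul0r.
Qed.

Let sum_q_eq0 (w : I -> R[i]) (m : I -> R[i]) :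
  (forall i, i \in s -> q.[m i] = 0) ->
  \sum_(k < size q) q`_k * \sum_(i <- s) w i * m i ^+ k = 0.
Proof.
move=> H; under eq_bigr do rewrite mulr_sumr.
rewrite exchange_big /= big_seq big1 // => i si.
under eq_bigr do rewrite mulrCA.
by rewrite -mulr_sumr -horner_coef H // mulr0.
Qed.

Let F_rec C x : \sum_(k < size q) q`_k * (F C k x)%:C = 0.
Proof.
pose w i := C i * cexp (mu i * x%:C).
have e k : (F C k x)%:C = 2^-1 *
   (\sum_(i <- s) w i * mu i ^+ k + \sum_(i <- s) (w i)^*%C * (mu i)^*%C ^+ k).
  rewrite /F ReJ_add mulrC; congr (_ * (_ + _)).
    by apply: eq_bigr => i _; rewrite /w mulrAC.
  by rewrite rmorph_sum /=; apply: eq_bigr => i _; rewrite -rmorphXn -rmorphM /w mulrAC.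
under eq_bigr do rewrite e mulrCA mulrDr.
rewrite -mulr_sumr big_split /= !sum_q_eq0 ?addr0 ?mulr0 // => i /q_root [] //.
Qed.

Let F_bound C x : `|F C (size q).-1 x| <=
  \sum_(k < (size q).-1) normc q`_k * `|F C k x|.
Proof.
have := F_rec C x.
have sq : size q = (size q).-1.+1 by rewrite prednK // size_poly_gt0 monic_neq0.
rewrite sq big_ord_recr /= -lead_coefE (monicP q_monic) mul1r.
move/eqP; rewrite addrC addr_eq0 => /eqP e.
rewrite -normc_real e normcN; apply: le_trans (ler_normc_sum _ _ _) _.
by apply: ler_sum => k _; rewrite Normc.normcM normc_real.
Qed.

Lemma segment_args_short : exists h n, 0 < h /\ forall C a b (th : R -> R),
  a <= b -> b - a <= h -> cont_on a b th ->
  (forall x, a <= x <= b ->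
     ph (\sum_(i <- s) C i * cexp (mu i * x%:C)) (th x)) ->
  `|th b - th a| <= pi *+ n.+1.
Proof.
pose S := \sum_(k < (size q).-1) normc q`_k.
have S0 : 0 <= S by apply: sumr_ge0 => k _; exact: normc_ge0.
have S1 : 0 < 1 + S by lra.
(* This [h] satisfies [h <= 1] and [h * S < 1], the smallness conditions of [short_interval_zeros];
   the order of the equation bounds the number of zeros. *)
exists (1 + S)^-1, (size q).-1; split; first by rewrite invr_gt0.
move=> C a b th ab bah cth H.
have h1 : (1 + S)^-1 <= 1 by rewrite invf_le1 // lerDl.
(* The sum has an argument, hence is nonzero; so [s] is nonempty and the monic [q] has a root. *)
have q1 : (0 < (size q).-1)%N.
  have := ph_neq0 (H a _); rewrite lexx ab => /(_ isT).
  case: s q_root => [|i t qr _]; first by rewrite big_nil eqxx.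
  have [q0 _] := qr i (mem_head _ _).
  rewrite ltnNge leqn0; apply/negP => /eqP sq1.
  have sq : (size q <= 1)%N by rewrite -[size q]prednK ?sq1 // size_poly_gt0 monic_neq0.
  have := q0; rewrite (size1_polyC sq) hornerC => /eqP; apply/negP.
  have : lead_coef q = 1 by apply/monicP.
  by rewrite lead_coefE sq1 => ->; exact: oner_neq0.
have FE x : a <= x <= b -> cos (th x) = 0 <-> F C 0 x = 0.
  move=> /H [r r0 e]; rewrite /F.
  under eq_bigr do rewrite expr0 mulr1.
  rewrite e ReM /= mul0r subr0.
  by split => [->|/eqP]; rewrite ?mulr0 // mulf_eq0 gt_eqF //= => /eqP.
have [[z [sz zz zP]]|none] := EM (exists z : seq R, [/\ sorted <%R z,
    size z = (size q).-1 & forall x, x \in z -> a <= x <= b /\ F C 0 x = 0]).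
  have F0 := @short_interval_zeros R (F C) (is_derive_Re_sum_cexp C) a b
    (size q).-1 (fun k => normc q`_k) z ab (le_trans bah h1)
    (fun k => normc_ge0 _) _ (F_bound C) q1 sz zz zP.
  have {}F0 x : a <= x <= b -> cos (th x) = 0.
    move=> xab; apply/(FE x xab)/F0 => //; rewrite -/S.
    apply: le_lt_trans (_ : (1 + S)^-1 * S < 1); first by rewrite ler_wpM2r.
    by rewrite mulrC ltr_pdivrMr // mul1r ltrDr.
  (* Here the sum is purely imaginary on the whole segment; a quarter turn yields a lift whose
     cosine never vanishes. *)
  have -> : th b - th a = (th b + pi / 2) - (th a + pi / 2) by ring.
  apply: le_trans (_ : _ <= pi *+ 1) _; last first.
    by rewrite [X in _ <= X]mulrS mulr1n lerDl mulrn_wge0 ?pi_ge0.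
  apply: (@lift_change_le _ a b (fun x => th x + pi / 2) 0 ab).
    by move=> x xab; apply: cvgD; [exact: cth|exact: cvg_cst].
  move=> [//|x t] _ /(_ x (mem_head _ _)) [/F0 c0]; rewrite cosDpihalf => /eqP.
  rewrite oppr_eq0 => /eqP s0; have := cos2Dsin2 (th x).
  by rewrite c0 s0 expr0n addr0 => /esym/eqP; rewrite oner_eq0.
apply: lift_change_le => // z sz zP; rewrite leqNgt; apply/negP => lt.
apply: none; exists (take (size q).-1 z); split.
- exact: take_sorted.
- by rewrite size_takel // ltnW.
- by move=> x /mem_take /zP [xab] /(FE x xab).
Qed.

(* Uniform in the coefficients [C]: this is what makes the bound independent of
   the position of the segment in the plane. *)
Lemma segment_args W : exists M, forall C a b (th : R -> R),
  a <= b -> b - a <= W -> cont_on a b th ->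
  (forall x, a <= x <= b ->
     ph (\sum_(i <- s) C i * cexp (mu i * x%:C)) (th x)) ->
  `|th b - th a| <= M.
Proof.
have [h [n [h0 H]]] := segment_args_short.
have [N WN] : exists N : nat, W <= h *+ N.
  exists (Num.truncn (W / h)).+1; rewrite -mulr_natr mulrC -ler_pdivrMr //.
  exact/ltW/truncnS_gt.
exists ((pi *+ n.+1) *+ N) => C a b th ab /le_trans/(_ WN) baN.
elim: N {WN} a ab baN => [|N IH] a ab baN cth ph_th.
  have -> : a = b by move: baN; rewrite mulr0n; lra.
  by rewrite subrr normr0.
have [bh|bh] := leP (b - a) h.
  apply: le_trans (H C a b th ab bh cth ph_th) _.
  rewrite [X in _ <= X]mulrS lerDl; do 2! apply: mulrn_wge0; exact: pi_ge0.
have ac : a <= a + h by rewrite lerDl ltW.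
have cb : a + h <= b by lra.
have -> : th b - th a = (th b - th (a + h)) + (th (a + h) - th a) by ring.
apply: le_trans (ler_normD _ _) _; rewrite [X in _ <= X]mulrSr; apply: lerD.
  apply: IH => //.
  - by move: baN; rewrite mulrS; set u := h *+ N; lra.
  - exact: cont_on_sub cth.
  - by move=> x /andP[cx xb]; apply: ph_th; rewrite (le_trans ac cx).
apply: (H C) => //.
- by rewrite addrAC subrr add0r.
- exact: cont_on_sub cth.
- by move=> x /andP[cx xb]; apply: ph_th; rewrite cx (le_trans xb cb).
Qed.

End SegmentSums.

(** * Taylor remainders of the exponential *)

Section Taylor.
Variable R : realType.
Local Notation normc := (@Normc.normc R).
Local Notation Re := (@complex.Re R).
Local Notation Im := (@complex.Im R).

Lemma ReMr (z : R[i]) (t : R) : Re (z * t%:C) = Re z * t.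
Proof. by rewrite ReM /= mulr0 subr0. Qed.

Definition exp_rem (m : nat) (u : R[i]) : R[i] :=
  cexp u - \sum_(k < m) u ^+ k / (k`!)%:R.

Lemma exp_remS m u : exp_rem m.+1 u = exp_rem m u - u ^+ m / (m`!)%:R.
Proof. by rewrite /exp_rem big_ord_recr /= opprD addrA. Qed.

Lemma exp_rem0n u : exp_rem 0 u = cexp u.
Proof. by rewrite /exp_rem big_ord0 subr0. Qed.

Lemma cexp0 : cexp 0 = 1 :> R[i].
Proof. by rewrite /cexp /= expR0 cos0 sin0 mulr1 mulr0. Qed.

Lemma cexpD (u v : R[i]) : cexp (u + v) = cexp u * cexp v.
Proof.
by apply: eqC; rewrite ?ReM ?ImM /= ?ReD ?ImD expRD ?cosD ?sinD; ring.
Qed.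

Lemma normc_cexp (u : R[i]) : normc (cexp u) = expR (Re u).
Proof.
by rewrite normcE /= !exprMn -mulrDr cos2Dsin2 mulr1 sqrtr_sqr ger0_norm ?expR_ge0.
Qed.

Lemma exp_rem0 m : exp_rem m.+1 0 = 0.
Proof.
rewrite /exp_rem cexp0 big_ord_recl /= big1 ?addr0 ?expr0 ?divr1 ?subrr // => k _.
by rewrite expr0n mul0r.
Qed.

(** Differentiation along a radius lowers the order of the remainder by one. The weight [w] lets the
    real mean value theorem serve both components. *)
Lemma is_derive_exp_rem m (u w : R[i]) (x : R) :
  is_derive x 1 (fun s => Re (w * exp_rem m.+1 (u * s%:C)))
    (Re (w * u * exp_rem m (u * x%:C))).
Proof.
elim: m => [|m IH].
  have -> : (fun s => Re (w * exp_rem 1 (u * s%:C))) =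
    (fun s => Re (w * cexp (u * s%:C))) - cst (Re w).
    by apply/funext => s; rewrite /exp_rem big_ord1 expr0 divr1 mulrBr mulr1 ReD ReN.
  rewrite exp_rem0n -[X in is_derive _ _ _ X]subr0.
  by apply: is_deriveB; exact: is_derive_Re_cexp.
pose r : R := Re (w * (u ^+ m.+1 / (m.+1)`!%:R)).
have -> : (fun s => Re (w * exp_rem m.+2 (u * s%:C))) =
  (fun s => Re (w * exp_rem m.+1 (u * s%:C))) - r \*: (fun s : R => s ^+ m.+1).
  apply/funext => s; rewrite exp_remS mulrBr ReD ReN; congr (_ - _).
  rewrite exprMn -rmorphXn mulrAC mulrA ReM /= mulr0 subr0.
  by rewrite -[RHS]/(r * s ^+ m.+1) /r.
have dX : is_derive x 1 (fun s : R => s ^+ m.+1) (m.+1%:R * x ^+ m).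
  have h := is_deriveX m.+1 (is_derive_id x (1 : R)).
  rewrite exprfctE in h.
  apply: (is_derive_eq h).
  by rewrite /= /GRing.scale /= mulr1.
apply: (is_derive_eq (is_deriveB IH (is_deriveZ r dX))).
rewrite exp_remS [in RHS]mulrBr ReD ReN; congr (_ - _).
rewrite -[LHS]/(r * _) /r -ReMr; congr Re.
rewrite rmorphM rmorph_nat rmorphXn factS natrM exprMn exprS.
have f0 : (m`!)%:R != 0 :> R[i] by rewrite pnatr_eq0 -lt0n fact_gt0.
have m0 : m.+1%:R != 0 :> R[i] by rewrite pnatr_eq0.
move: f0 m0; move: (m`!%:R) (m.+1%:R) => p q p0 q0; field.
by rewrite p0 q0.
Qed.

Lemma exp_rem_Re_le m (u w : R[i]) (K : R) : normc w = 1 ->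
  (forall s : R, 0 <= s <= 1 -> normc (exp_rem m (u * s%:C)) <= K) ->
  `|Re (w * exp_rem m.+1 u)| <= normc u * K.
Proof.
move=> w1 H.
have d x := is_derive_exp_rem m u w x.
have [|s] := @MVT_segment _ (fun s => Re (w * exp_rem m.+1 (u * s%:C)))
   (fun s => Re (w * u * exp_rem m (u * s%:C))) 0 1 ler01.
  apply: continuous_subspaceT => x; apply: differentiable_continuous.
  by apply/derivable1_diffP; have := d x => -[].
rewrite in_itv /= => s01.
rewrite mulr1 mulr0 exp_rem0 mulr0 subr0 subr0 mulr1 => ->.
apply: le_trans (ler_Re_normc _) _.
by rewrite !Normc.normcM w1 mul1r ler_wpM2l ?normc_ge0 // H.
Qed.

Lemma exp_rem_le m : exists2 K : R, 0 <= K &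
  forall u : R[i], normc u <= 1 -> normc (exp_rem m u) <= K * normc u ^+ m.
Proof.
elim: m => [|m [K K0 H]].
  exists (expR 1); first exact: expR_ge0.
  move=> u u1; rewrite exp_rem0n normc_cexp expr0 mulr1 ler_expR.
  by rewrite (le_trans (ler_norm _)) // (le_trans (ler_Re_normc _)).
exists (K + K); first exact: addr_ge0.
move=> u u1.
have Hs (s : R) : 0 <= s <= 1 -> normc (exp_rem m (u * s%:C)) <= K * normc u ^+ m.
  move=> /andP[s0 s1].
  have us : normc (u * s%:C) <= normc u.
    by rewrite Normc.normcM normc_real ger0_norm // ler_piMr ?normc_ge0.
  apply: le_trans (H _ (le_trans us u1)) _.
  by rewrite ler_wpM2l // lerXn2r ?nnegrE ?normc_ge0.
have hR := @exp_rem_Re_le m u 1 _ (Normc.normc1 _) Hs.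
(* Multiplication by [-i] turns the imaginary part into a real part; bounding both components
   doubles the constant. *)
have ni : normc (0 -i* 1 : R[i]) = 1.
  by rewrite normcE /= sqrrN expr0n add0r expr1n sqrtr1.
have hI := @exp_rem_Re_le m u (0 -i* 1) _ ni Hs.
apply: le_trans (ler_normc_ReIm _) _.
rewrite mulrDl exprS mulrCA; apply: lerD; first by rewrite -[exp_rem _ _]mul1r.
by move: hI; rewrite ReM /= mul0r sub0r mulN1r opprK.
Qed.

End Taylor.

(** * Derivatives of exponential sums *)

Section ExpSum.
Variable R : realType.
Local Notation normc := (@Normc.normc R).
Local Notation Re := (@complex.Re R).
Local Notation Im := (@complex.Im R).
Variable L : {fset R[i]}.
Implicit Types (c : R[i] -> R[i]) (a z w : R[i]).

(* Coefficients of the [k]-th derivative of [expsum L c]. *)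
Definition dcoef c (k : nat) (l : R[i]) : R[i] := c l * l^* ^+ k.

Lemma dcoefD c j k l : dcoef (dcoef c j) k l = dcoef c (j + k) l.
Proof. by rewrite /dcoef exprD mulrA. Qed.

Lemma expsum_taylor c a m : exists2 K : R, 0 <= K & exists2 d : R, 0 < d &
  forall w, normc w <= d ->
    normc (expsum L c (a + w) -
      \sum_(k < m) expsum L (dcoef c k) a * w ^+ k / (k`!)%:R)
    <= K * normc w ^+ m.
Proof.
have [K K0 HK] := exp_rem_le R m.
pose S := \sum_(l <- L) normc l^*.
have S0 : 0 <= S by apply: sumr_ge0 => l _; exact: normc_ge0.
have S1 : 0 < 1 + S by lra.
pose B := \sum_(l <- L) normc (c l * cexp (l^* * a)) * (K * normc l^* ^+ m).
exists B.
  apply: sumr_ge0 => l _; rewrite mulr_ge0 ?normc_ge0 // mulr_ge0 //.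
  by rewrite exprn_ge0 ?normc_ge0.
(* Within this radius every [l^* * w] lies in the unit disc, where [exp_rem_le] applies. *)
exists (1 + S)^-1; first by rewrite invr_gt0.
move=> w wd.
have -> : expsum L c (a + w) -
      \sum_(k < m) expsum L (dcoef c k) a * w ^+ k / (k`!)%:R =
  \sum_(l <- L) c l * cexp (l^* * a) * exp_rem m (l^* * w).
  under eq_bigr do rewrite /expsum -mulrA mulr_suml.
  rewrite exchange_big /= -sumrB; apply: eq_bigr => l _.
  rewrite /exp_rem mulrBr mulrDr cexpD mulrA; congr (_ - _).
  rewrite mulr_sumr; apply: eq_bigr => k _; rewrite /dcoef exprMn; ring.
apply: le_trans (ler_normc_sum _ _ _) _; rewrite /B mulr_suml.
rewrite big_seq [X in _ <= X]big_seq; apply: ler_sum => l lL.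
rewrite Normc.normcM -[X in _ <= X]mulrA ler_wpM2l ?normc_ge0 //.
rewrite -mulrA -exprMn -Normc.normcM; apply: HK.
rewrite Normc.normcM; apply: le_trans (_ : (1 + S) * normc w <= _).
  rewrite ler_wpM2r ?normc_ge0 // /S (big_rem l) //=.
  set T := \sum_(_ <- _) _; have : 0 <= T; last lra.
  by apply: sumr_ge0 => i _; exact: normc_ge0.
by rewrite mulrC -ler_pdivlMr // mul1r.
Qed.

Lemma derive1_eq_eps (K : numFieldType) (f : K -> K^o) (a l : K) :
  (forall e : K, 0 < e -> exists2 d : K, 0 < d & forall h, h != 0 -> `|h| < d ->
     `|l - h^-1 * (f (h + a) - f a)| <= e) -> derive1 f a = l.
Proof.
move=> H; rewrite /derive1; apply: cvg_lim; first exact: norm_hausdorff.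
apply/cvgrPdist_le => /= e /H [d d0 Hd].
near=> h; apply: Hd; near: h; first exact: nbhs_dnbhs_neq.
exact: dnbhs0_lt.
Unshelve. all: by end_near. Qed.

Lemma norm_realC (z : R[i]) : `|z| = (normc z)%:C.
Proof. by []. Qed.

Lemma derive1_expsum c :
  derive1 (expsum L c : R[i] -> R[i]^o) = expsum L (dcoef c 1).
Proof.
apply/funext => a; apply: derive1_eq_eps => e e0.
have [K K0 [d d0 H]] := expsum_taylor c a 2.
have ee : e = (Re e)%:C by rewrite RRe_real // gtr0_real.
have e1 : 0 < Re e by rewrite -ltcR -ee.
exists (Num.min d (Re e / (K + 1)))%:C.
  by rewrite ltcR lt_min d0 divr_gt0 //; lra.
move=> h h0; rewrite norm_realC ltcR lt_min => /andP[/ltW hd /ltW he].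
rewrite ler_pdivlMr in he; last lra.
rewrite mulrC in he.
rewrite ee norm_realC lecR; apply: le_trans he.
have := H h hd.
rewrite big_ord_recr big_ord1 /= fact0 (factS 0) fact0 expr0 expr1 !divr1 mulr1.
have -> : expsum L (dcoef c 0) a = expsum L c a.
  by apply: eq_bigr => l _; rewrite /dcoef expr0 mulr1.
move=> Hh.
have -> : expsum L (dcoef c 1) a - h^-1 * (expsum L c (h + a) - expsum L c a)
  = - (h^-1 * (expsum L c (a + h) - (expsum L c a + expsum L (dcoef c 1) a * h))).
  by rewrite [h + a]addrC; field.
rewrite normcN Normc.normcM Normc.normcV ler_pdivrMl ?normc_gt0 //.
apply: le_trans Hh _.
rewrite [X in _ <= X](_ : _ = (K + 1) * normc h ^+ 2); last by ring.
rewrite ler_wpM2r ?exprn_ge0 ?normc_ge0 //; lra.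
Qed.

Lemma derive1n_expsum c j :
  derive1n j (expsum L c : R[i] -> R[i]^o) = expsum L (dcoef c j).
Proof.
elim: j c => [|j IH] c /=.
  by apply/funext => a; apply: eq_bigr => l _; rewrite /dcoef expr0 mulr1.
rewrite -[LHS]/(derive1 (derive1n j _)) IH derive1_expsum.
by apply/funext => a; apply: eq_bigr => l _; rewrite dcoefD addn1.
Qed.

End ExpSum.

(** * Limits and compactness in the plane; arguments on star-shaped sets *)

Section PlaneTopology.
Variable R : realType.
Local Notation normc := (@Normc.normc R).
Local Notation Re := (@complex.Re R).
Local Notation Im := (@complex.Im R).

(* Convergence in [R[i]] is expressed componentwise, [R[i]] itself carrying no
   topology. *)
Definition ccvg (T : Type) (F : set_system T) (g : T -> R[i]) (l : R[i]) :=
  (Re (g x) @[x --> F] --> Re l) /\ (Im (g x) @[x --> F] --> Im l).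

Section Filters.
Variables (T : Type) (F : set_system T).
Context {FF : Filter F}.
Implicit Types (g h : T -> R[i]) (l m : R[i]).

Lemma ccvg_cst l : ccvg F (fun=> l) l.
Proof. by split; exact: cvg_cst. Qed.

Lemma ccvgD g h l m : ccvg F g l -> ccvg F h m -> ccvg F (fun x => g x + h x) (l + m).
Proof.
move=> [gr gi] [hr hi]; split; rewrite ?ReD ?ImD.
  by under eq_fun do rewrite ReD; exact: cvgD.
by under eq_fun do rewrite ImD; exact: cvgD.
Qed.

Lemma ccvgN g l : ccvg F g l -> ccvg F (fun x => - g x) (- l).
Proof.
move=> [gr gi]; split; rewrite ?ReN ?ImN.
  by under eq_fun do rewrite ReN; exact: cvgN.
by under eq_fun do rewrite ImN; exact: cvgN.
Qed.

Lemma ccvgB g h l m : ccvg F g l -> ccvg F h m -> ccvg F (fun x => g x - h x) (l - m).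
Proof. by move=> gl hm; apply: ccvgD => //; exact: ccvgN. Qed.

Lemma ccvgM g h l m : ccvg F g l -> ccvg F h m -> ccvg F (fun x => g x * h x) (l * m).
Proof.
move=> [gr gi] [hr hi]; split; rewrite ?ReM ?ImM.
  by under eq_fun do rewrite ReM; apply: cvgB; exact: cvgM.
by under eq_fun do rewrite ImM; apply: cvgD; exact: cvgM.
Qed.

Lemma ccvg_sqr_norm g l : ccvg F g l ->
  (Re (g x) ^+ 2 + Im (g x) ^+ 2) @[x --> F] --> Re l ^+ 2 + Im l ^+ 2.
Proof. by move=> [gr gi]; apply: cvgD; rewrite expr2; exact: cvgM. Qed.

Lemma ccvgV g l : l != 0 -> ccvg F g l -> ccvg F (fun x => (g x)^-1) l^-1.
Proof.
move=> l0 gl; have n0 : Re l ^+ 2 + Im l ^+ 2 != 0.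
  by rewrite -normc_sqr expf_neq0 // normc_eq0.
have nl := ccvg_sqr_norm gl; case: gl => gr gi.
split; rewrite ?ReV ?ImV.
  by under eq_fun do rewrite ReV; apply: cvgM => //; exact: cvgV.
by under eq_fun do rewrite ImV; apply: cvgN; apply: cvgM => //; exact: cvgV.
Qed.

Lemma ccvgX g l n : ccvg F g l -> ccvg F (fun x => g x ^+ n) (l ^+ n).
Proof.
move=> gl; elim: n => [|n IH].
  by under eq_fun do rewrite expr0; rewrite expr0; exact: ccvg_cst.
by under eq_fun do rewrite exprS; rewrite exprS; exact: ccvgM.
Qed.

Lemma ccvg_prod (I : Type) (s : seq I) (P : pred I) (g : I -> T -> R[i]) (l : I -> R[i]) :
  (forall i, P i -> ccvg F (g i) (l i)) ->
  ccvg F (fun x => \prod_(i <- s | P i) g i x) (\prod_(i <- s | P i) l i).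
Proof.
move=> H; elim: s => [|i s IH].
  by under eq_fun do rewrite big_nil; rewrite big_nil; exact: ccvg_cst.
under eq_fun do rewrite big_cons; rewrite big_cons; case: ifP => // Pi.
by apply: ccvgM => //; exact: H.
Qed.

Lemma cvg_normc g l : ccvg F g l -> normc (g x) @[x --> F] --> normc l.
Proof.
move=> gl; under eq_fun do rewrite normcE; rewrite normcE.
apply: (@cvg_comp _ _ _ _ Num.sqrt _ (nbhs (Re l ^+ 2 + Im l ^+ 2))).
  exact: ccvg_sqr_norm.
exact: sqrt_continuous.
Qed.

Lemma cvg_parg g l : slit l -> ccvg F g l -> parg (g x) @[x --> F] --> parg l.
Proof.
move=> sl gl; have nl := cvg_normc gl; case: gl => gr gi.
rewrite /parg; apply: cvgM; first exact: cvg_cst.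
apply: (@cvg_comp _ _ _ _ atan _ (nbhs (Im l / (normc l + Re l)))).
  by apply: cvgM => //; apply: cvgV; [rewrite gt_eqF|exact: cvgD].
exact: continuous_atan.
Qed.

Lemma ccvgP g l : ccvg F g l <->
  forall e : R, 0 < e -> \forall x \near F, normc (g x - l) < e.
Proof.
split=> [gl e e0|H].
  have := cvg_normc (ccvgB gl (ccvg_cst l)).
  rewrite subrr Normc.normc0 => /cvgrPdist_lt /(_ e e0).
  by apply: filterS => x; rewrite sub0r normrN ger0_norm ?normc_ge0.
split; apply/cvgrPdist_lt => e /H; apply: filterS => x.
  by apply: le_lt_trans; rewrite distrC -ReN -ReD ler_Re_normc.
by apply: le_lt_trans; rewrite distrC -ImN -ImD ler_Im_normc.
Qed.

End Filters.

(** Stands in for the neighbourhoods of [z], with [normc] as distance. *)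
Definition cball (z : R[i]) : set_system R[i] :=
  [set A | exists2 d : R, 0 < d & forall w, normc (w - z) < d -> A w].

Global Instance cball_filter z : Filter (cball z).
Proof.
split.
- by exists 1.
- move=> P Q [d d0 dP] [e e0 eQ]; exists (Num.min d e); first by rewrite lt_min d0.
  by move=> w; rewrite lt_min => /andP[/dP ? /eQ].
- by move=> P Q PQ [d d0 dP]; exists d => // w /dP /PQ.
Qed.

Lemma ccvg_id z : ccvg (cball z) id z.
Proof. by apply/ccvgP => e e0; exists e. Qed.

Lemma ccvg_ball (T : Type) (F : set_system T) {FF : Filter F} (g : T -> R[i]) z
  (P : set R[i]) : ccvg F g z -> cball z P -> \forall x \near F, P (g x).
Proof.
move=> /ccvgP gz [d d0 dP]; have := gz d d0; apply: filterS => x; exact: dP.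
Qed.

Lemma ccvg_comp (T : Type) (F : set_system T) {FF : Filter F}
  (g : T -> R[i]) (h : R[i] -> R[i]) z l :
  ccvg F g z -> ccvg (cball z) h l -> ccvg F (h \o g) l.
Proof.
move=> gz /ccvgP hl; apply/ccvgP => e /hl he.
exact: (ccvg_ball gz he).
Qed.

Lemma cvg_comp_cball (T : Type) (F : set_system T) {FF : Filter F} (g : T -> R[i]) z
  (th : R[i] -> R) (l : R) :
  ccvg F g z -> (th w @[w --> cball z] --> l) -> th (g x) @[x --> F] --> l.
Proof. by move=> gz thl A /thl; exact: ccvg_ball. Qed.

(** Compactness in near-covering form, inherited from a square in the real plane. The filter is
    arbitrary: radii tending to 0 give uniform continuity, growing finite lists give finiteness of
    the zeros. *)
Lemma disc_compact (rho : R) (I : Type) (F : set_system I) {FF : Filter F}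
  (P : I -> R[i] -> Prop) :
  (forall z0, exists2 d : R, 0 < d &
     \forall i \near F, forall z, normc (z - z0) < d -> P i z) ->
  \forall i \near F, forall z, normc z <= rho -> P i z.
Proof.
move=> H.
have := @compact_setX _ _ _ _ (@segment_compact R (- rho) rho)
                              (@segment_compact R (- rho) rho).
move=> /compact_near_coveringP.
move=> /(_ I F (fun i p => P i (p.1 +i* p.2)) FF).
have h : forall x : R * R, (`[- rho, rho]%classic `*` `[- rho, rho]%classic)%classic x ->
    \forall x' \near x & i \near F, P i (x'.1 +i* x'.2).
  move=> [x y] _; have [d d0 Hd] := H (x +i* y).
  (* Half of [d] for each coordinate, as the modulus is at most the sum of their absolute values. *)
  exists (ball (x, y) (d / 2), [set i | forall z, normc (z - (x +i* y)) < d -> P i z]).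
    by split => //=; apply: nbhsx_ballx; rewrite divr_gt0.
  move=> [[x' y'] i] /= [[bx bY] Hi]; apply: Hi.
  apply: le_lt_trans (ler_normc_ReIm _) _ => /=.
  rewrite /ball /= in bx bY.
  rewrite [d]splitr; apply: ltrD; by rewrite distrC.
move=> /(_ h); apply: filterS => i Hi z zr.
have := Hi (Re z, Im z) => /=; rewrite (_ : Re z +i* Im z = z); last by case: (z).
apply; rewrite !in_itv /= -!ler_norml.
by split; apply: le_trans zr; rewrite ?ler_Re_normc ?ler_Im_normc.
Qed.

(* A continuous nonvanishing function on a star-shaped compact set has a
   continuous argument: cut each radius into [n] pieces so short that the
   quotients of successive values stay close to 1, and add up the principal
   arguments of these quotients. *)
Lemma starshaped_arg (K : set R[i]) (rho : R) (g : R[i] -> R[i]) :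
  (forall z, K z -> normc z <= rho) ->
  (forall z, ~ K z -> cball z (~` K)%classic) ->
  (forall z (t : R), K z -> 0 <= t <= 1 -> K (t%:C * z)) ->
  (forall z, K z -> g z != 0) ->
  (forall z, K z -> ccvg (cball z) g (g z)) ->
  exists A : R[i] -> R,
    (forall z, K z -> A w @[w --> cball z] --> A z) /\
    (forall z, K z -> ph (g z / g 0) (A z)).
Proof.
move=> Krho Kclosed Kstar g0 gcont.
have step : \forall d \near 0^'+, forall z, normc z <= rho -> K z -> forall w, K w ->
    normc (w - z) < d -> normc (g w / g z - 1) < 1.
  (* Near a point outside [K] the claim is vacuous, by closedness. *)
  apply: disc_compact => z0; have [Kz0|nKz0] := EM (K z0); last first.
    have [d d0 Hd] := Kclosed z0 nKz0; exists d => //.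
    by near=> e => z /Hd.
  (* With a third, [g w] and [g z] differ by less than two thirds of [normc (g z0)], which is less
     than [normc (g z)]. *)
  have gz0 : 0 < normc (g z0) / 3 by rewrite divr_gt0 // normc_gt0 g0.
  have /ccvgP/(_ _ gz0) [d d0 Hd] := gcont z0 Kz0.
  exists (d / 2); first by rewrite divr_gt0.
  near=> e => z zd Kz w Kw wz.
  have hz : normc (g z - g z0) < normc (g z0) / 3 by apply: Hd; lra.
  have hw : normc (g w - g z0) < normc (g z0) / 3.
    apply: Hd; rewrite (_ : w - z0 = (w - z) + (z - z0)); last by ring.
    apply: le_lt_trans (le_normcD _ _) _.
    have : e < d / 2 by near: e; apply: nbhs_right_lt; rewrite divr_gt0.
    lra.
  have gz : 0 < normc (g z) by rewrite normc_gt0 g0.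
  have -> : g w / g z - 1 = (g w - g z) / g z by field; exact: g0.
  rewrite Normc.normcM Normc.normcV ltr_pdivrMr // mul1r.
  have h1 : normc (g z0) <= normc (g z) + normc (g z - g z0).
    rewrite [X in normc X <= _](_ : g z0 = g z + - (g z - g z0)); last by ring.
    by rewrite (le_trans (le_normcD _ _)) // normcN.
  have h2 : normc (g w - g z) <= normc (g w - g z0) + normc (g z - g z0).
    rewrite [X in normc X <= _](_ : _ = (g w - g z0) + - (g z - g z0)); last by ring.
    by rewrite (le_trans (le_normcD _ _)) // normcN.
  lra.
have [d d0 Hd] : exists2 d : R, 0 < d & forall z w, K z -> K w ->
    normc (w - z) < d -> normc (g w / g z - 1) < 1.
  case: step => e /= e0 He; exists (e / 2); first by rewrite divr_gt0.
  move=> z w Kz Kw; apply: (He (e / 2)) => //=; last exact: Krho.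
    by rewrite sub0r normrN gtr0_norm ?divr_gt0 // ltr_pdivrMr // ltr_pMr // ltr1n.
  by rewrite divr_gt0.
pose n := (Num.truncn (rho / d)).+1.
have nd : rho < n%:R * d by rewrite -ltr_pdivrMr //; exact: truncnS_gt.
have n0 : 0 < n%:R :> R by rewrite ltr0n.
pose p (k : nat) (z : R[i]) : R[i] := (k%:R / n%:R)%:C * z.
have Kp k z : (k <= n)%N -> K z -> K (p k z).
  move=> kn Kz; apply: Kstar => //; rewrite divr_ge0 ?ler0n //=.
  by rewrite ler_pdivrMr // mul1r ler_nat.
have quot k z : (k < n)%N -> K z -> normc (g (p k.+1 z) / g (p k z) - 1) < 1.
  move=> kn Kz; apply: Hd; [apply: Kp => //; exact: ltnW|exact: Kp|].
  rewrite /p -mulrBl -rmorphB -mulrBl -natrB // subSnn mul1r.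
  rewrite Normc.normcM normc_real ger0_norm ?invr_ge0 ?ler0n //.
  rewrite mulrC ltr_pdivrMr // mulrC; apply: le_lt_trans nd; exact: Krho.
exists (fun z => \sum_(k < n) parg (g (p k.+1 z) / g (p k z))); split => z Kz.
  have hs (s : seq 'I_n) :
      \sum_(k <- s) parg (g (p k.+1 w) / g (p k w)) @[w --> cball z] -->
      \sum_(k <- s) parg (g (p k.+1 z) / g (p k z)).
    elim: s => [|k s IH].
      by under eq_fun do rewrite big_nil; rewrite big_nil; exact: cvg_cst.
    under eq_fun do rewrite big_cons; rewrite big_cons; apply: cvgD => //.
    apply: cvg_parg; first by apply: slit_near1; exact: quot.
    have pc j : (j <= n)%N -> ccvg (cball z) (fun w => g (p j w)) (g (p j z)).
      move=> jn; apply: (@ccvg_comp _ _ _ (p j) g (p j z)); last exact/gcont/Kp.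
      by apply: ccvgM; [exact: ccvg_cst|exact: ccvg_id].
    apply: ccvgM; first exact: pc.
    by apply: ccvgV; [apply/g0/Kp => //; exact: ltnW|apply: pc; exact: ltnW].
  exact: hs.
have hm m : (m <= n)%N ->
    ph (g (p m z) / g 0) (\sum_(k < m) parg (g (p k.+1 z) / g (p k z))).
  elim: m => [_|m IH mn].
    rewrite big_ord0 /p mul0r mul0r mulfV; first exact: ph1.
    apply: g0; have := Kstar z 0 Kz; rewrite mul0r; apply.
    by rewrite lexx ler01.
  rewrite big_ord_recr /= addrC.
  rewrite (_ : g (p m.+1 z) / g 0 =
     (g (p m.+1 z) / g (p m z)) * (g (p m z) / g 0)); last first.
    by rewrite mulrA divfK // g0 //; apply: Kp => //; exact: ltnW.
  apply: phM; last by apply: IH; exact: ltnW.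
  by apply: ph_parg; apply: slit_near1; exact: quot.
have := hm n (leqnn n).
by rewrite {1}/p divff ?gt_eqF // mul1r.
Unshelve. all: by end_near. Qed.

End PlaneTopology.

(** * Orders of zeros, their finiteness, and division by them *)

Section Zeros.
Variable R : realType.
Local Notation normc := (@Normc.normc R).
Local Notation Re := (@complex.Re R).
Local Notation Im := (@complex.Im R).
Variables (L : {fset R[i]}) (c : R[i] -> R[i]).
Hypothesis L_neq0 : L != fset0.
Hypothesis c_neq0 : forall l, l \in L -> c l != 0.
Let f := expsum L c.

Lemma expsum_dcoef0 z : expsum L (dcoef c 0) z = f z.
Proof. by apply: eq_bigr => l _; rewrite /dcoef expr0 mulr1. Qed.

Lemma cexp_neq0 (z : R[i]) : cexp z != 0.
Proof. exact: ph_neq0 (ph_cexp z). Qed.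

(** If all derivatives vanished at [z], so would all their combinations; a polynomial vanishing at
    every conjugate frequency but one isolates a single term, which is nonzero. *)
Lemma exists_derivative_neq0 z : exists k, expsum L (dcoef c k) z != 0.
Proof.
apply: contrapT => /forallNP H.
have {}H k : expsum L (dcoef c k) z = 0 by apply/eqP/negPn/negP/H.
have [l0 l0L] := fset0Pn _ L_neq0.
pose p : {poly R[i]} := \prod_(l <- L | l != l0) ('X - (l^*)%:P).
have : \sum_(l <- L) c l * cexp (l^* * z) * p.[l^*] = 0.
  under eq_bigr do rewrite horner_coef mulr_sumr.
  rewrite exchange_big /= big1 // => k _.
  transitivity (p`_k * expsum L (dcoef c k) z); last by rewrite H mulr0.
  rewrite /expsum mulr_sumr.
  by apply: eq_bigr => l _; rewrite /dcoef; ring.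
rewrite (bigD1_seq l0) ?fset_uniq //= big1_seq ?addr0; last first.
  move=> l /andP[ll0 lL]; rewrite /p horner_prod (big_rem l) //= ll0.
  by rewrite hornerXsubC subrr mul0r mulr0.
apply/eqP; rewrite !mulf_neq0 ?c_neq0 ?cexp_neq0 //.
rewrite /p horner_prod prodf_seq_neq0; apply/allP => l lL; apply/implyP => ll0.
rewrite hornerXsubC subr_eq0; apply: contraNneq ll0 => /(can_inj (@conjCK _)) ->.
exact: eqxx.
Qed.

Definition ord z : nat := ex_minn (exists_derivative_neq0 z).
(** Leading Taylor coefficient at [z]; away from the zeros it is [f z] itself. *)
Definition lead z : R[i] := expsum L (dcoef c (ord z)) z / (ord z)`!%:R.

Lemma ord_min z j : (j < ord z)%N -> expsum L (dcoef c j) z = 0.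
Proof.
rewrite /ord; case: ex_minnP => m _ H jm; apply/eqP; rewrite -[_ == _]negbK.
by apply/negP => /H; rewrite leqNgt jm.
Qed.

Lemma lead_neq0 z : lead z != 0.
Proof.
rewrite /lead /ord; case: ex_minnP => m Hm _.
by rewrite mulf_neq0 ?invr_eq0 ?pnatr_eq0 -?lt0n ?fact_gt0.
Qed.

Lemma ord_eq0 z : f z != 0 -> ord z = 0%N.
Proof.
move=> fz; apply/eqP; rewrite -leqn0 leqNgt; apply/negP => /ord_min.
by rewrite expsum_dcoef0; apply/eqP.
Qed.

Lemma lead_nonzero z : f z != 0 -> lead z = f z.
Proof. by move=> fz; rewrite /lead ord_eq0 // divr1 expsum_dcoef0. Qed.

Lemma vanishing_order_expsum z : vanishing_order f z = (ord z)%:R%:E.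
Proof.
rewrite /vanishing_order; apply/eqP; rewrite eq_le; apply/andP; split.
  apply: ge_ereal_sup => _ [k Hk <-]; rewrite lee_fin ler_nat leqNgt.
  apply/negP => /Hk; rewrite derive1n_expsum => /eqP.
  apply/negP; rewrite /ord; case: ex_minnP => //.
apply: ereal_sup_ubound; exists (ord z) => // j jm.
by rewrite derive1n_expsum ord_min.
Qed.

Definition loc z w : R[i] := if w == z then lead z else f w / (w - z) ^+ ord z.

Lemma ccvg_loc z : ccvg (cball z) (loc z) (lead z).
Proof.
have [K K0 [d d0 H]] := expsum_taylor L c z (ord z).+1.
apply/ccvgP => e e0; exists (Num.min d (e / (K + 1))).
  by rewrite lt_min d0 divr_gt0 //; lra.
move=> w; rewrite lt_min => /andP[/ltW wd we]; rewrite /loc.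
case: eqVneq => [_|wz]; first by rewrite subrr Normc.normc0.
have wz0 : w - z != 0 by rewrite subr_eq0.
have n0 : 0 < normc (w - z) by rewrite normc_gt0.
have := H (w - z) wd; rewrite addrCA subrr addr0 big_ord_recr /= big1; last first.
  by move=> k _; rewrite ord_min // !mul0r.
rewrite add0r -/f => Hf.
have -> : f w / (w - z) ^+ ord z - lead z =
   (f w - expsum L (dcoef c (ord z)) z * (w - z) ^+ ord z / (ord z)`!%:R)
    / (w - z) ^+ ord z.
  rewrite mulrBl /lead; congr (_ - _).
  by rewrite [RHS]mulrAC mulfK ?expf_neq0.
rewrite Normc.normcM Normc.normcV ltr_pdivrMr ?normc_gt0 ?expf_neq0 //.
apply: le_lt_trans Hf _.
have -> : normc ((w - z) ^+ ord z) = normc (w - z) ^+ ord z.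
  elim: (ord z) => [|n IH]; first by rewrite !expr0 Normc.normc1.
  by rewrite !exprS Normc.normcM IH.
rewrite exprS mulrA ltr_pM2r ?exprn_gt0 //.
move: we; rewrite ltr_pdivlMr; last lra.
by rewrite mulrDr mulr1 [K * _]mulrC; lra.
Qed.

Lemma isolated_zeros z : exists2 d : R, 0 < d &
  forall w, normc (w - z) < d -> w != z -> f w != 0.
Proof.
have n0 : 0 < normc (lead z) by rewrite normc_gt0 lead_neq0.
have /ccvgP/(_ _ n0) [d d0 H] := ccvg_loc z.
exists d => // w /H + wz; rewrite /loc (negPf wz).
apply: contraTneq => ->; by rewrite mul0r sub0r normcN ltxx.
Qed.

Lemma finite_zeros (rho : R) : exists2 zs : seq R[i], uniq zs &
  forall z, (z \in zs) = (normc z <= rho) && (f z == 0).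
Proof.
(* Filter of the properties that hold for all lists containing some given list. Near each point only
   the point itself can be a zero, so compactness leaves one list catching every zero. *)
pose F : set_system (seq R[i]) :=
  [set A : set (seq R[i]) | exists s0 : seq R[i],
       forall s : seq R[i], {subset s0 <= s} -> A s].
have FF : Filter F.
  split.
  - by exists [::].
  - move=> P Q [s Ps] [t Qt]; exists (s ++ t) => u H.
    by split; [apply: Ps|apply: Qt] => x xs; apply: H; rewrite mem_cat xs ?orbT.
  - by move=> P Q PQ [s Ps]; exists s => u /Ps /PQ.
have : \forall s \near F, forall z, normc z <= rho -> f z = 0 -> z \in s.
  apply: disc_compact => z0; have [d d0 H] := isolated_zeros z0.
  exists d => //; exists [:: z0] => s sub z /H zz0 fz.
  have [->|/zz0] := eqVneq z z0; first by apply: sub; rewrite mem_head.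
  by rewrite fz eqxx.
move=> [s /(_ s (fun=> id)) sP].
exists (undup [seq z <- s | (normc z <= rho) && (f z == 0)]); first exact: undup_uniq.
move=> z; rewrite mem_undup mem_filter andbC.
case: (boolP ((normc z <= rho) && _)) => [/andP[zr /eqP fz]|]; last by rewrite andbF.
by rewrite sP.
Qed.

Variables (zs : seq R[i]).
Hypothesis zs_uniq : uniq zs.
Hypothesis zs_zero : forall a, a \in zs -> f a = 0.

(* [f] divided by the zeros in [zs], with the removable singularities filled. *)
Definition cofactor z : R[i] := lead z / \prod_(a <- zs | a != z) (z - a) ^+ ord a.

Lemma cofactor_den_neq0 z : \prod_(a <- zs | a != z) (z - a) ^+ ord a != 0.
Proof.
rewrite prodf_seq_neq0; apply/allP => a _; apply/implyP => az.
by rewrite expf_neq0 // subr_eq0 eq_sym.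
Qed.

Lemma cofactor_neq0 z : cofactor z != 0.
Proof. by rewrite mulf_neq0 ?lead_neq0 ?invr_eq0 ?cofactor_den_neq0. Qed.

Lemma expsum_cofactor z : f z != 0 ->
  f z = \prod_(a <- zs) (z - a) ^+ ord a * cofactor z.
Proof.
move=> fz; rewrite /cofactor lead_nonzero // mulrCA.
rewrite [X in _ * (X / _)](_ : _ = \prod_(a <- zs | a != z) (z - a) ^+ ord a).
  by rewrite mulfV ?mulr1 ?cofactor_den_neq0.
rewrite big_seq [RHS]big_seq_cond; apply: eq_bigl => a.
case: (boolP (a \in zs)) => //= /zs_zero fa; apply/esym.
by apply: contraNneq fz => <-; rewrite fa.
Qed.

Lemma ccvg_cofactor z : (f z = 0 -> z \in zs) ->
  ccvg (cball z) cofactor (cofactor z).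
Proof.
move=> fz.
(* Near [z] the cofactor is [loc z] divided by the factors of the other zeros. If [z] is not in
   [zs], its order is 0 and its own factor is 1. *)
pose h w := loc z w / \prod_(a <- zs | a != z) (w - a) ^+ ord a.
have ch : ccvg (cball z) h (cofactor z).
  apply: ccvgM; first exact: ccvg_loc.
  apply: ccvgV; first exact: cofactor_den_neq0.
  apply: ccvg_prod => a _; apply: ccvgX; apply: ccvgB; first exact: ccvg_id.
  exact: ccvg_cst.
have [d d0 Hd] := isolated_zeros z.
apply/ccvgP => e e0; have /ccvgP/(_ e e0) [d' d'0 Hd'] := ch.
exists (Num.min d d'); first by rewrite lt_min d0.
move=> w; rewrite lt_min => /andP[wd wd'].
suff -> : cofactor w = h w by exact: Hd'.
rewrite /cofactor /h /loc; case: eqVneq => [->//|wz].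
have fw := Hd w wd wz.
have wzs : w \notin zs by apply: contraNN fw => /zs_zero ->.
rewrite lead_nonzero // -mulrA -invfM; congr (_ / _).
have -> : \prod_(a <- zs | a != w) (w - a) ^+ ord a = \prod_(a <- zs) (w - a) ^+ ord a.
  rewrite big_seq_cond [RHS]big_seq; apply: eq_bigl => a.
  case: (boolP (a \in zs)) => //= azs; by apply: contraNneq wzs => <-.
have [zzs|zzs] := boolP (z \in zs); first by rewrite (bigD1_seq z).
have fz0 : f z != 0 by apply: contraNneq zzs => /fz.
rewrite ord_eq0 // expr0 mul1r big_seq [RHS]big_seq_cond; apply: eq_bigl => a.
case: (boolP (a \in zs)) => //= azs; apply/esym; by apply: contraNneq zzs => <-.
Qed.

End Zeros.

(** * The cut disc and the argument principle *)

Section CutDisc.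
Variable R : realType.
Local Notation normc := (@Normc.normc R).
Local Notation Re := (@complex.Re R).
Local Notation Im := (@complex.Im R).

(** Scalar product with the unit vector [cis t]. *)
Definition prj (t : R) (z : R[i]) : R := Re z * cos t + Im z * sin t.

Lemma prj_le_normc t z : `|prj t z| <= normc z.
Proof.
have -> : prj t z = Re (z * cis (- t)) by rewrite ReM /= cosN sinN mulrN opprK.
by rewrite (le_trans (ler_Re_normc _)) // Normc.normcM normc_cis mulr1.
Qed.

Lemma prjB t z w : prj t (z - w) = prj t z - prj t w.
Proof. by rewrite /prj ReD ImD ReN ImN; ring. Qed.

Lemma prjZ t (k : R) z : prj t (k%:C * z) = k * prj t z.
Proof. by rewrite /prj ReM ImM /= mul0r; ring. Qed.

Variables (ts : seq R) (rho r : R).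
Hypothesis r_gt0 : 0 < r.
Hypothesis rho_gt0 : 0 < rho.

Definition cut_disc : set R[i] :=
  [set z | normc z <= rho /\ forall t, t \in ts -> prj t z <= r].

Definition cut_circle (z : R[i]) : Prop :=
  cut_disc z /\ (normc z = rho \/ exists2 t, t \in ts & prj t z = r).

Lemma cut_disc_star z (t : R) : cut_disc z -> 0 <= t <= 1 -> cut_disc (t%:C * z).
Proof.
move=> [zr zt] /andP[t0 t1]; split.
  rewrite Normc.normcM normc_real ger0_norm // (le_trans _ zr) //.
  by rewrite ler_piMl // normc_ge0.
move=> u /zt uz; rewrite prjZ; have [p0|p0] := leP 0 (prj u z).
  by rewrite (le_trans _ uz) // ler_piMl.
by rewrite (le_trans _ (ltW r_gt0)) // mulr_ge0_le0 // ltW.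
Qed.

Lemma cut_disc_closed z : ~ cut_disc z -> cball z (~` cut_disc)%classic.
Proof.
move=> nz; have [zr|zr] := leP (normc z) rho; last first.
  exists (normc z - rho); first by rewrite subr_gt0.
  move=> w wz [wr _].
  have : normc z <= normc w + normc (w - z).
    rewrite [X in normc X <= _](_ : z = w + - (w - z)); last by ring.
    by rewrite (le_trans (le_normcD _ _)) // normcN.
  lra.
have [t tts zt] : exists2 t, t \in ts & r < prj t z.
  apply: contrapT => h; apply: nz; split => // t tts.
  by rewrite leNgt; apply/negP => rt; apply: h; exists t.
exists (prj t z - r); first by rewrite subr_gt0.
move=> w wz [_ /(_ t tts) wt].
have := le_lt_trans (prj_le_normc t (w - z)) wz.
by rewrite ltr_norml prjB; lra.
Qed.

Lemma cut_circle_neq0 z : cut_circle z -> z != 0.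
Proof.
move=> [_ [h|[t _ h]]]; apply/eqP => z0.
  by move: rho_gt0; rewrite -h z0 Normc.normc0 ltxx.
by move: r_gt0; rewrite -h z0 /prj !mul0r addr0 ltxx.
Qed.

(* A point of the region lies on no ray that continues outwards from a
   boundary point. *)
Lemma slit_cut_circle z a : cut_circle z -> cut_disc a -> a != z ->
  slit (1 - a / z).
Proof.
move=> bz [ar at_] az; have z0 := cut_circle_neq0 bz.
rewrite slitP; apply/negP => /andP[/eqP im0 re0].
pose k : R := Re (a / z).
have ak : a = k%:C * z.
  rewrite -[LHS](divfK z0); congr (_ * _); apply: eqC => //=.
  by move: im0; rewrite ImD ImN /= add0r => /eqP; rewrite oppr_eq0 => /eqP.
have k1 : 1 <= k by move: re0; rewrite ReD ReN /= -/k; lra.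
have /eqP : k = 1.
  apply/eqP; rewrite eq_le k1 andbT; case: bz => _ [h|[t tts h]].
    move: ar; rewrite ak Normc.normcM normc_real h ger0_norm; last lra.
    by rewrite ger_pMl.
  by have := at_ t tts; rewrite ak prjZ h ger_pMl.
by move=> /eqP k1'; move: az; rewrite ak k1' mul1r eqxx.
Qed.

Variables (L : {fset R[i]}) (c : R[i] -> R[i]).
Hypothesis L_neq0 : L != fset0.
Hypothesis c_neq0 : forall l, l \in L -> c l != 0.
Local Notation f := (expsum L c).
Local Notation ordf := (ord L_neq0 c_neq0).
Hypothesis f_neq0 : forall z, cut_circle z -> f z != 0.

(* Argument principle: along the boundary the argument of [f] is that of
   [z ^ N] up to a single-valued function, [N] being the number of zeros. *)
Lemma argument_principle (zs : seq R[i]) : uniq zs ->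
  (forall z, z \in zs <-> cut_disc z /\ f z = 0) ->
  exists G : R[i] -> R,
   (forall z, cut_circle z -> G w @[w --> cball z] --> G z) /\
   (forall z t, cut_circle z -> ph z t ->
      ph (f z) ((\sum_(a <- zs) ordf a)%:R * t + G z)).
Proof.
move=> uzs zsP.
have zs0 a : a \in zs -> f a = 0 by move=> /zsP [].
pose g := cofactor L_neq0 c_neq0 zs.
have g0 z : g z != 0 by exact: cofactor_neq0.
have [|||||A [cA pA]] := @starshaped_arg R cut_disc rho g.
- by move=> z [].
- exact: cut_disc_closed.
- exact: cut_disc_star.
- by move=> z _; exact: g0.
- by move=> z Kz; apply: ccvg_cofactor => // fz; apply/zsP.
have [t0 [ht0 _]] := ph_exists_pi (g0 0).
(* From [z - a = z * (1 - a / z)], each zero contributes, with its order, [t] and the principal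
   argument of the second factor, continuous by [slit_cut_circle]. [A] and [t0] account for the
   cofactor. *)
exists (fun z => \sum_(a <- zs) (ordf a)%:R * parg (1 - a / z) + (A z + t0)).
have sl z a : cut_circle z -> a \in zs -> slit (1 - a / z).
  move=> bz /zsP [Ka fa]; apply: slit_cut_circle => //.
  by apply/eqP => az; have := f_neq0 bz; rewrite -az fa eqxx.
split=> [z bz|z t bz pz].
  have Kz : cut_disc z by case: bz.
  apply: cvgD; last by apply: cvgD; [exact: cA|exact: cvg_cst].
  have : {subset zs <= zs} by [].
  elim: {1 3 4}zs => [|a s IH] sub.
    by under eq_fun do rewrite big_nil; rewrite big_nil; exact: cvg_cst.
  under eq_fun do rewrite big_cons; rewrite big_cons.
  apply: cvgD; last by apply: IH => x xs; apply: sub; rewrite in_cons xs orbT.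
  apply: cvgM; first exact: cvg_cst.
  apply: cvg_parg; first by apply: sl => //; apply: sub; exact: mem_head.
  apply: ccvgB; first exact: ccvg_cst.
  apply: ccvgM; first exact: ccvg_cst.
  by apply: ccvgV; [exact: cut_circle_neq0|exact: ccvg_id].
have z0 := cut_circle_neq0 bz.
rewrite (expsum_cofactor L_neq0 c_neq0 zs0); last exact: f_neq0.
rewrite -/g addrA; apply: phM; last first.
  rewrite -[X in ph X _](divfK (g0 0)); apply: phM => //; apply: pA.
  by case: bz.
rewrite natr_sum mulr_suml -big_split /=.
apply: ph_prod => a azs; rewrite -mulrDr mulr_natl; apply: phX.
have -> : z - a = z * (1 - a / z) by rewrite mulrBr mulr1 mulrCA divff ?mulr1.
by apply: phM => //; apply: ph_parg; exact: sl.
Qed.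

End CutDisc.

(** * Change of argument along one chord and along one arc *)

Section BoundaryPieces.
Variable R : realType.
Local Notation normc := (@Normc.normc R).
Local Notation Re := (@complex.Re R).
Local Notation Im := (@complex.Im R).

Lemma ccvg_cexp (T : Type) (F : set_system T) {FF : Filter F} (g : T -> R[i]) l :
  ccvg F g l -> ccvg F (fun x => cexp (g x)) (cexp l).
Proof.
move=> [gr gi].
have e : expR (Re (g x)) @[x --> F] --> expR (Re l).
  by apply: (@cvg_comp _ _ _ _ expR _ (nbhs (Re l))) => //; exact: continuous_expR.
split; apply: cvgM => //.
  by apply: (@cvg_comp _ _ _ _ cos _ (nbhs (Im l))) => //; exact: continuous_cos.
by apply: (@cvg_comp _ _ _ _ sin _ (nbhs (Im l))) => //; exact: continuous_sin.
Qed.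

Lemma ccvg_expsum (T : Type) (F : set_system T) {FF : Filter F} (g : T -> R[i]) l
    (L : {fset R[i]}) c :
  ccvg F g l -> ccvg F (fun x => expsum L c (g x)) (expsum L c l).
Proof.
move=> gl; rewrite /expsum; elim: (enum_fset L) => [|k s IH].
  by under eq_fun do rewrite big_nil; rewrite big_nil; exact: ccvg_cst.
under eq_fun do rewrite big_cons; rewrite big_cons; apply: ccvgD => //.
apply: ccvgM; first exact: ccvg_cst.
by apply: ccvg_cexp; apply: ccvgM => //; exact: ccvg_cst.
Qed.

Lemma ccvg_cis (x : R) : ccvg (nbhs x) (@cis R) (cis x).
Proof. by split; [exact: continuous_cos|exact: continuous_sin]. Qed.

Lemma ph_atan (r s : R) : 0 < r -> ph (r +i* s) (atan (s / r)).
Proof.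
move=> r0; set u := atan _.
have c0 : 0 < cos u by apply: cos_gt0_pihalf; rewrite atan_gtNpi2 atan_ltpi2.
have tu : sin u = s / r * cos u by rewrite -[s / r]atanK /tan divfK // gt_eqF.
exists (r / cos u); first exact: divr_gt0.
apply: eqC; rewrite ?ReM ?ImM /= mul0r ?subr0 ?addr0.
  by rewrite divfK // gt_eqF.
by rewrite tu; field; rewrite !gt_eqF.
Qed.

(** Coordinates in the frame rotated by [t]: for fixed [r], varying [s] describes the line
    [prj t z = r]. *)
Definition chord (t r s : R) : R[i] := cis t * (r +i* s).

Section Pieces.
Variables (L : {fset R[i]}).

(* [G] is the single-valued part of the argument of [expsum L c] on the
   boundary, as provided by [argument_principle]. *)
Definition arg_rest c (ts : seq R) (rho r : R) (N : nat) (G : R[i] -> R) :=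
  (forall z, cut_circle ts rho r z -> G w @[w --> cball z] --> G z) /\
  (forall z t, cut_circle ts rho r z -> ph z t ->
     ph (expsum L c z) (N%:R * t + G z)).

Lemma arg_rest_cont c ts rho r N G (F : R -> R[i]) (th : R -> R) a b :
  arg_rest c ts rho r N G -> cont_on a b th ->
  (forall s, a <= s <= b -> ccvg (nbhs s) F (F s)) ->
  (forall s, a <= s <= b -> cut_circle ts rho r (F s)) ->
  cont_on a b (fun s => N%:R * th s + G (F s)).
Proof.
move=> [G1 G2] cth cF bF s sab; apply: cvgD.
  by apply: cvgM; [exact: cvg_cst|exact: cth].
by apply: (cvg_comp_cball (cF s sab)); apply: G1; exact: bF.
Qed.

(** In [l^* * chord t r s] the part containing [r] is constant in [s] and goes into the
    coefficients, leaving frequencies that depend on [l] and [t] only. Hence [M] comes before [c],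
    [rho] and [r]. *)
Lemma chord_change (t W : R) : exists M, forall c ts rho r N G a b,
  arg_rest c ts rho r N G -> 0 < r -> a <= b -> b - a <= W ->
  (forall s, a <= s <= b -> cut_circle ts rho r (chord t r s)) ->
  `|N%:R * (atan (b / r) - atan (a / r)) + (G (chord t r b) - G (chord t r a))| <= M.
Proof.
have [M HM] := segment_args (enum_fset L) (fun l => l^* * cis t * (0 +i* 1)) W.
exists M => c ts rho r N G a b AG r0 ab bW bd.
pose th s := N%:R * (t + atan (s / r)) + G (chord t r s).
rewrite (_ : _ + _ = th b - th a); last by rewrite /th; ring.
apply: (HM (fun l => c l * cexp (l^* * cis t * r%:C))) => //.
  apply: arg_rest_cont AG _ _ _ => //; last first.
    move=> s _; apply: ccvgM; first exact: ccvg_cst.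
    by split; [exact: cvg_cst|exact: cvg_id].
  move=> s _; apply: cvgD; first exact: cvg_cst.
  apply: (@cvg_comp _ _ _ _ atan _ (nbhs (s / r))); last exact: continuous_atan.
  by apply: cvgM; [exact: cvg_id|exact: cvg_cst].
move=> s sab; case: AG => _ /(_ _ (t + atan (s / r)) (bd s sab)) H.
suff -> : \sum_(l <- L) c l * cexp (l^* * cis t * r%:C) *
    cexp (l^* * cis t * (0 +i* 1) * s%:C) = expsum L c (chord t r s).
  apply: H; apply: phM; last exact: ph_atan.
  by exists 1 => //; rewrite mul1r.
apply: eq_bigr => l _; rewrite -mulrA -cexpD; congr (_ * cexp _); rewrite /chord.
have -> : r +i* s = r%:C + (0 +i* 1) * s%:C :> R[i] by apply: eqC => /=; ring.
by rewrite !mulrDr !mulrA.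
Qed.

(** The quotient of the sum by its [v] term stays within 1 of 1, so its principal argument is
    continuous and smaller than [pi] in size; the discrepancy is the difference of its two end
    values. *)
Lemma arc_change c ts rho r N G v a b : arg_rest c ts rho r N G -> 0 < rho ->
  v \in L -> c v != 0 -> a <= b ->
  (forall s, a <= s <= b -> cut_circle ts rho r (rho%:C * cis s)) ->
  (forall s, a <= s <= b -> \sum_(l <- L | l != v)
     normc (c l / c v) * expR (Re ((l - v)^* * (rho%:C * cis s))) < 1) ->
  `|N%:R * (b - a) + (G (rho%:C * cis b) - G (rho%:C * cis a))
    - (Im (v^* * (rho%:C * cis b)) - Im (v^* * (rho%:C * cis a)))| <= pi *+ 2.
Proof.
move=> AG rho0 vL cv0 ab bd dom.
pose z s := rho%:C * cis s.
pose q w := expsum L c w / (c v * cexp (v^* * w)).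
have den w : c v * cexp (v^* * w) != 0 by rewrite mulf_neq0 ?cexp_neq0.
have [t0 [ht0 _]] := ph_exists_pi cv0.
have zc s : ccvg (nbhs s) z (z s).
  by apply: ccvgM; [exact: ccvg_cst|exact: ccvg_cis].
have vz s : ccvg (nbhs s) (fun y => v^* * z y) (v^* * z s).
  by apply: ccvgM => //; exact: ccvg_cst.
have q1 s : a <= s <= b -> normc (q (z s) - 1) < 1.
  move=> /dom; apply: le_lt_trans.
  have -> : q (z s) - 1 = \sum_(l <- L | l != v) c l / c v * cexp ((l - v)^* * z s).
    rewrite /q /expsum (bigD1_seq v) ?fset_uniq //= mulrDl divff // addrAC subrr add0r.
    rewrite mulr_suml; apply: eq_bigr => l _.
    have -> : l^* * z s = (l - v)^* * z s + v^* * z s.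
      by rewrite -mulrDl -rmorphD /= subrK.
    rewrite cexpD; have := cexp_neq0 (v^* * z s); move: cv0.
    move: (cexp _) (cexp _) (c l) (c v) => E V p u u0 V0.
    by field; rewrite u0 V0.
  apply: le_trans (ler_normc_sum _ _ _) _.
  by apply: ler_sum => l _; rewrite Normc.normcM normc_cexp.
pose th1 s := N%:R * s + G (z s).
pose th2 s := (t0 + Im (v^* * z s)) + parg (q (z s)).
have e : th1 b - th1 a = th2 b - th2 a.
  apply: (@lift_unique _ a b) => //.
  - by apply: arg_rest_cont AG _ _ _.
  - move=> s sab; apply: cvgD.
      apply: cvgD; first exact: cvg_cst.
      by case: (vz s).
    apply: cvg_parg; first by apply: slit_near1; exact: q1.
    apply: ccvgM; first by apply: ccvg_expsum; exact: zc.
    apply: ccvgV => //; apply: ccvgM; first exact: ccvg_cst.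
    by apply: ccvg_cexp; exact: vz.
  - move=> s sab; apply: (@ph_uniq _ (expsum L c (z s))).
      case: AG => _; apply; first exact: bd.
      by exists rho.
    rewrite -[X in ph X _](divfK (den (z s))) -/(q (z s)) /th2 addrC; apply: phM.
      by apply: ph_parg; apply: slit_near1; exact: q1.
    by apply: phM => //; exact: ph_cexp.
rewrite (_ : _ - _ = parg (q (z b)) - parg (q (z a))); last first.
  transitivity (th1 b - th1 a - (Im (v^* * z b) - Im (v^* * z a))).
    by rewrite /th1; ring.
  by rewrite e /th2; ring.
have := parg_bound (q (z b)); have := parg_bound (q (z a)).
rewrite mulr2n !ltr_norml ler_norml => /andP[? ?] /andP[? ?].
by apply/andP; split; lra.
Qed.

End Pieces.
End BoundaryPieces.

(** * Vertices maximising the projection in a direction *)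

Section Vertices.
Variable R : realType.
Local Notation normc := (@Normc.normc R).
Local Notation Re := (@complex.Re R).
Local Notation Im := (@complex.Im R).
Implicit Types (t x y s : R) (w v l : R[i]).

(** Component along the direction [t] after a quarter turn; also the derivative of [prj x w] in [x]
    at [t]. *)
Definition oprj t w : R := Im w * cos t - Re w * sin t.

Lemma prjD t v w : prj t (v + w) = prj t v + prj t w.
Proof. by rewrite /prj ReD ImD; ring. Qed.

Lemma oprjD t v w : oprj t (v + w) = oprj t v + oprj t w.
Proof. by rewrite /oprj ReD ImD; ring. Qed.

Lemma prjN t w : prj t (- w) = - prj t w.
Proof. by rewrite /prj ReN ImN; ring. Qed.

Lemma oprjN t w : oprj t (- w) = - oprj t w.
Proof. by rewrite /oprj ReN ImN; ring. Qed.

Lemma prj_rot t x w : prj x w = cos (x - t) * prj t w + sin (x - t) * oprj t w.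
Proof.
have := cos2Dsin2 t.
rewrite cosB sinB /prj /oprj; move: (cos t) (sin t) => a b e.
transitivity ((Re w * cos x + Im w * sin x) * (a ^+ 2 + b ^+ 2)).
  by rewrite e mulr1.
by ring.
Qed.

Lemma prj_sqr t w : prj t w ^+ 2 + oprj t w ^+ 2 = normc w ^+ 2.
Proof.
rewrite normc_sqr /prj /oprj -[RHS]mulr1 -(cos2Dsin2 t); ring.
Qed.

Lemma prj_eq0 t w : prj t w = 0 -> oprj t w = 0 -> w = 0.
Proof.
move=> p0 o0; have := prj_sqr t w; rewrite p0 o0 expr0n addr0 => /esym/eqP.
by rewrite expf_eq0 /= normc_eq0 => /eqP.
Qed.

Lemma continuous_prj w : continuous (fun t => prj t w).
Proof.
move=> t; apply: cvgD; apply: cvgM; try exact: cvg_cst.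
  exact: continuous_cos.
exact: continuous_sin.
Qed.

(* Order in which the points win the projection contest just after ([s = 1])
   or just before ([s = -1]) the direction of angle [t]. *)
Definition lexpos s t w := 0 < prj t w \/ (prj t w = 0 /\ 0 < s * oprj t w).

Lemma lexpos_total s t w : s != 0 -> w != 0 -> lexpos s t w \/ lexpos s t (- w).
Proof.
move=> s0 w0; rewrite /lexpos prjN oprjN.
have [p|p|p] := ltgtP 0 (prj t w); first by left; left.
  by right; left; rewrite oppr_gt0.
have o0 : s * oprj t w != 0.
  rewrite mulf_neq0 //; apply: contraNneq w0 => o0; apply/eqP.
  exact: (@prj_eq0 t).
have [q|q|/esym/eqP] := ltgtP 0 (s * oprj t w); last by rewrite (negPf o0).
  by left; right.
by right; right; rewrite -p oppr0 mulrN oppr_gt0.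
Qed.

Lemma lexposD s t v w : lexpos s t v -> lexpos s t w -> lexpos s t (v + w).
Proof.
rewrite /lexpos prjD oprjD => -[a|[a a']] [b|[b b']].
- by left; lra.
- by left; lra.
- by left; lra.
- right; split; first by rewrite a b addr0.

  by rewrite [X in 0 < X]mulrDr; exact: addr_gt0.
Qed.

Lemma lexpos_irr s t w : lexpos s t w -> lexpos s t (- w) -> False.
Proof.
by rewrite /lexpos prjN oprjN mulrN => -[a|[a a']] [b|[b b']]; lra.
Qed.

Variable L : {fset R[i]}.
Hypothesis L_neq0 : L != fset0.

Definition is_vtx s t v :=
  v \in L /\ forall l, l \in L -> l != v -> lexpos s t (v - l).

Lemma exists_vtx s t : s != 0 -> exists v, is_vtx s t v.
Proof.
move=> s0; rewrite /is_vtx.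
have : enum_fset L != [::] :> seq R[i].
  have [l lL] := fset0Pn _ L_neq0; apply/eqP => e.
  by have : l \in enum_fset L by []; rewrite e.
suff H : forall r : seq R[i], r != [::] -> exists v, v \in r /\
    forall l, l \in r -> l != v -> lexpos s t (v - l) by exact: H.
elim=> // a [|b r] IH _.
  by exists a; rewrite mem_head; split => // l; rewrite inE => /eqP ->; rewrite eqxx.
have [|v [vr vP]] := IH; first by [].
have [av|av] := eqVneq a v.
  exists a; rewrite mem_head; split => // l; rewrite inE => /orP[->//|lr].
  by rewrite av; exact: vP.
have [|h|h] := @lexpos_total s t (a - v) s0; first by rewrite subr_eq0.
  exists a; rewrite mem_head; split => // l.
  rewrite inE => /orP[/eqP ->|lr la]; first by rewrite eqxx.
  have [->//|lv] := eqVneq l v.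
  rewrite (_ : a - l = (a - v) + (v - l)); last by ring.
  by apply: lexposD => //; exact: vP.
exists v; rewrite inE vr orbT; split => // l.
rewrite inE => /orP[/eqP -> _|]; last exact: vP.
by rewrite -opprB.
Qed.

Lemma is_vtx_uniq s t v v' : is_vtx s t v -> is_vtx s t v' -> v = v'.
Proof.
move=> [vL vP] [v'L v'P]; apply/eqP/negPn/negP => vv'.
apply: (@lexpos_irr s t (v - v')); last by rewrite opprB; apply: v'P.
by apply: vP => //; rewrite eq_sym.
Qed.

(** When [t] is the outer normal of a side, [vtx (-1) t] and [vtx 1 t] are the two ends of that
    side; otherwise they coincide. *)
Definition vtx s t : R[i] := xget 0 (is_vtx s t).

Lemma vtxP s t : s != 0 -> is_vtx s t (vtx s t).
Proof.
by move=> s0; have [v vP] := exists_vtx t s0; exact: (xgetI 0 vP).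
Qed.

Lemma vtx_eq s t v : s != 0 -> is_vtx s t v -> vtx s t = v.
Proof. by move=> s0 vP; apply: is_vtx_uniq vP; exact: vtxP. Qed.

Lemma prj_ge_vtx s t v l : is_vtx s t v -> l \in L -> prj t l <= prj t v.
Proof.
move=> [_ vP] lL; have [->//|lv] := eqVneq l v.
have [h|[h _]] := vP l lL lv; move: h; rewrite prjB; lra.
Qed.

Definition no_ties (x y : R) := forall l l', l \in L -> l' \in L -> l != l' ->
  forall z, x < z < y -> prj z (l - l') != 0.

Lemma vtx_arc t t' l : t < t' -> no_ties t t' -> l \in L -> l != vtx 1 t ->
  (forall x, t < x < t' -> 0 < prj x (vtx 1 t - l)) /\
  (forall x, t <= x <= t' -> 0 <= prj x (vtx 1 t - l)).
Proof.
move=> tt' nt lL lv; set v := vtx 1 t; set w := v - l.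
have [vL vP] := vtxP t (oner_neq0 R).
have n0 x : t < x < t' -> prj x w != 0 by apply: nt => //; rewrite eq_sym.
have cw a b : {within `[a, b], continuous (fun x => prj x w)}.
  by apply: continuous_subspaceT; exact: continuous_prj.
have pos x : t < x < t' -> 0 < prj x w.
  move=> /andP[tx xt']; have [pt|[pt ot]] := vP l lL lv; rewrite -/v -/w in pt.
    rewrite ltNge; apply/negP => px.
    have [|y] := @IVT _ (fun x => prj x w) t x 0 (ltW tx) (cw _ _).
      by rewrite ge_min le_max px (ltW pt) orbT.
    rewrite in_itv /= => /andP[ty yx] py.
    have : prj y w != 0.
      apply: n0; rewrite (le_lt_trans yx) // andbT lt_neqAle ty andbT.
      by apply: contraTneq pt => ->; rewrite py ltxx.
    by rewrite py eqxx.
  rewrite -/v -/w mul1r in ot; have [xp|px] := ltP (x - t) pi.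
    rewrite (prj_rot t) pt mulr0 add0r mulr_gt0 //; apply: sin_gt0_pi.
    by rewrite subr_gt0 tx.
  (* After a tie at [t] the projection is proportional to [sin (x - t)] and vanishes again at
     [t + pi]; without ties the interval must stop there at the latest. *)
  have := n0 (t + pi); rewrite (prj_rot t) pt mulr0 add0r addrAC subrr add0r.
  rewrite sinpi mul0r eqxx => h; exfalso.
  have : t < t + pi < t' by rewrite ltrDl pi_gt0 /=; lra.
  by move=> /h.
split => // x /andP[tx xt'].
have [->|tx'] := eqVneq x t.
  by have [|[-> _]] := vP l lL lv; first exact: ltW.
have [->|xt''] := eqVneq x t'; last first.
  by apply/ltW/pos; rewrite lt_neqAle eq_sym tx' tx lt_neqAle xt''.
rewrite leNgt; apply/negP => pt'.
pose m := (t + t') / 2.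
have m1 : t < m < t' by rewrite /m; lra.
have pm := pos m m1.
case/andP: m1 => tm mt'.
have [|y] := @IVT _ (fun x => prj x w) m t' 0 (ltW mt') (cw _ _).
  by rewrite ge_min le_max (ltW pt') (ltW pm) orbT.
rewrite in_itv /= => /andP[my yt'] py.
have : prj y w != 0.
  apply: n0; rewrite (lt_le_trans tm) //= lt_neqAle yt' andbT.
  by apply: contraTneq pt' => <-; rewrite py ltxx.
by rewrite py eqxx.
Qed.

(** The winner cannot change without a tie, so the vertex winning just after [t] still wins just
    before [t']. If it is tied at [t'], having been ahead earlier forces a negative [oprj]. *)
Lemma vtx_before t t' : t < t' -> no_ties t t' -> vtx (-1) t' = vtx 1 t.
Proof.
move=> tt' nt; have [vL vP] := vtxP t (oner_neq0 R).
apply: vtx_eq; first by rewrite oppr_eq0 oner_eq0.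
split => // l lL lv; have [pos nneg] := vtx_arc tt' nt lL lv.
set w := vtx 1 t - l in pos nneg *.
have : 0 <= prj t' w by apply: nneg; rewrite lexx ltW.
rewrite le_eqVlt => /orP[/eqP p0|]; last by left.
right; split => //; rewrite mulN1r oppr_gt0.
(* Inside the interval and close enough to [t'] for [sin (t' - x)] to be positive. *)
pose x := Num.max ((t + t') / 2) (t' - pi / 2).
have p := pi_gt0 R.
have xt : t < x < t'.
  by rewrite lt_max gt_max; apply/andP; split; [apply/orP; left|apply/andP; split]; lra.
have := pos x xt; rewrite (prj_rot t') -p0 mulr0 add0r.
have : sin (t' - x) > 0.
  apply: sin_gt0_pi; apply/andP; split; first by case/andP: xt; lra.
  have : t' - pi / 2 <= x by rewrite le_max lexx orbT.
  lra.
rewrite -opprB sinN => s0; rewrite -[_ * _]opprK -mulNr oppr_gt0.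
by rewrite pmulr_rlt0.
Qed.

End Vertices.

(** * The finite list of tie directions *)

Section Angles.
Variable R : realType.
Local Notation normc := (@Normc.normc R).
Local Notation Re := (@complex.Re R).
Local Notation Im := (@complex.Im R).

Lemma exists_uniform (T : eqType) (s : seq T) (P : T -> R -> Prop) :
  (forall t M M', M <= M' -> P t M -> P t M') ->
  (forall t, t \in s -> exists M, P t M) ->
  exists M, forall t, t \in s -> P t M.
Proof.
move=> mono; elim: s => [|a s IH] H; first by exists 0.
have [M1 HM1] := H a (mem_head _ _).
have [|M2 HM2] := IH; first by move=> t ts; apply: H; rewrite in_cons ts orbT.
exists (Num.max M1 M2) => t; rewrite in_cons => /orP[/eqP ->|ts].
  by apply: mono HM1; rewrite le_max lexx.
by apply: mono (HM2 t ts); rewrite le_max lexx orbT.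
Qed.

Lemma cos_eq0_pi (y : R) : 0 <= y <= pi -> cos y = 0 -> y = pi / 2.
Proof.
move=> yp y0; apply: cos_inj; rewrite ?in_itv //= ?y0 ?cos_pihalf //.
have := pi_gt0 R; move: (pi : R) => p p0; apply/andP; split; lra.
Qed.

Lemma cos_eq0_2pi (y : R) : `|y| <= pi *+ 2 -> cos y = 0 ->
  y \in [:: pi / 2; - (pi / 2); pi / 2 + pi; - (pi / 2 + pi)].
Proof.
move=> y2; rewrite -cos_norm => c0.
have [yp|yp] := leP `|y| pi.
  have := cos_eq0_pi _ c0; rewrite normr_ge0 yp => /(_ isT).
  move=> /eqP; rewrite eqr_norml => /andP[/orP[] /eqP -> _]; rewrite !inE eqxx ?orbT //.
have c1 : cos (`|y| - pi) = 0.
  by have := cosDpi (`|y| - pi); rewrite subrK c0 => /esym/eqP; rewrite oppr_eq0 => /eqP.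
have := cos_eq0_pi _ c1; rewrite subr_ge0 (ltW yp) lerBlDr -mulr2n y2 => /(_ isT).
move/eqP; rewrite subr_eq eqr_norml => /andP[/orP[] /eqP -> _].
  by rewrite !inE eqxx !orbT.
by rewrite !inE eqxx !orbT.
Qed.

Lemma cos_le_away (d y : R) : 0 <= d <= pi -> d <= `|y| <= pi *+ 2 - d ->
  cos y <= cos d.
Proof.
move=> /andP[d0 dp] /andP[dy yd]; rewrite -cos_norm.
have mono (u : R) : d <= u <= pi -> cos u <= cos d.
  move=> /andP[du up]; rewrite leNgt ltr_cos -?leNgt // in_itv /= ?d0 // up andbT.
  exact: le_trans du.
have [yp|yp] := leP `|y| pi; first by apply: mono; rewrite dy.
have -> : cos `|y| = cos (pi *+ 2 - `|y|).
  by rewrite -cosN -cosD2pi addrC.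
apply: mono; rewrite lerBrDr -lerBrDl yd /= lerBlDl mulr2n lerD2r ltW //.
Qed.

(** A tie direction is perpendicular to some [l - l']. [pi] is appended so that the list, started at
    [- pi], makes a full turn. *)
Lemma exists_angles (L : {fset R[i]}) : exists ts : seq R,
  [/\ path <%R (- pi) ts, last (- pi) ts = pi &
   forall l l', l \in L -> l' \in L -> l != l' -> forall x : R, - pi < x <= pi ->
     prj x (l - l') = 0 -> x \in ts].
Proof.
pose arg w : R := xget 0 [set t | ph w t /\ `|t| <= pi].
(* Offsets from [arg] at which the cosine vanishes: both angles lie between [- pi] and [pi], so the
   difference is at most [pi *+ 2] in size and four offsets suffice. *)
pose cand := [seq a + k | a <- [seq arg (l - l') | l <- enum_fset L, l' <- enum_fset L],
   k <- [:: pi / 2; - (pi / 2); pi / 2 + pi; - (pi / 2 + pi)]].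
pose s := sort <=%R (undup [seq x <- cand | - pi < x < pi]).
have sE x : (x \in s) = (- pi < x < pi) && (x \in cand).
  by rewrite /s mem_sort mem_undup mem_filter.
have ss : sorted <%R s by rewrite sort_lt_sorted undup_uniq.
exists (rcons s pi); split.
- rewrite rcons_path path_min_sorted ?ss /=; last first.
    by apply/allP => x; rewrite sE => /andP[/andP[]].
  have := mem_last (- pi) s; rewrite inE sE => /orP[/eqP ->|/andP[/andP[]]] //.
  by rewrite gtrN ?pi_gt0.
- by rewrite last_rcons.
move=> l l' lL l'L ll' x /andP[px xp] p0.
rewrite mem_rcons inE sE px /= lt_neqAle xp andbT; case: (x == pi) => //=.
have [t tP] := @ph_exists_pi _ (l - l') (ltac:(by rewrite subr_eq0)).
have [[r r0 e] ap] : ph (l - l') (arg (l - l')) /\ `|arg (l - l')| <= pi.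
  by have := @xgetI _ 0 [set t | ph (l - l') t /\ `|t| <= pi] t tP.
have c0 : cos (x - arg (l - l')) = 0.
  move: e p0; set a := arg _ => ->; rewrite prjZ => /eqP.
  rewrite mulf_eq0 gt_eqF //= => /eqP <-.
  by rewrite cosB /prj /cis /=; ring.
apply/allpairsP; exists (arg (l - l'), x - arg (l - l')) => /=; split.
- by apply/allpairsP; exists (l, l').
- apply: cos_eq0_2pi => //; apply: le_trans (ler_normB _ _) _.
  by rewrite mulr2n lerD // ler_norml xp ltW.
- by rewrite addrC subrK.
Qed.

End Angles.

(** * Total change of argument around the cut disc *)

Section BoundaryTotal.
Variable R : realType.
Local Notation normc := (@Normc.normc R).
Local Notation Re := (@complex.Re R).
Local Notation Im := (@complex.Im R).

Lemma normc_sqrt_eq (z : R[i]) (k : R) : 0 <= k ->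
  Re z ^+ 2 + Im z ^+ 2 = k ^+ 2 -> normc z = k.
Proof. by move=> k0 e; rewrite normcE e sqrtr_sqr ger0_norm. Qed.

Lemma normc_conj (z : R[i]) : normc z^* = normc z.
Proof. by case: z => a b; rewrite !normcE /= sqrrN. Qed.

Lemma ph_polar (z : R[i]) t : ph z t -> z = (normc z)%:C * cis t.
Proof.
move=> [k k0 ->]; rewrite Normc.normcM normc_cis mulr1 normc_real.
by rewrite ger0_norm // ltW.
Qed.

Lemma prj_chord u t (r s : R) :
  prj u (chord t r s) = r * cos (u - t) + s * sin (u - t).
Proof. by rewrite /prj /chord ReM ImM /= cosB sinB; ring. Qed.

Lemma normc_chord t (r s : R) : normc (chord t r s) = Num.sqrt (r ^+ 2 + s ^+ 2).
Proof. by rewrite /chord Normc.normcM normc_cis mul1r. Qed.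

Lemma prj_cis u (k s : R) : prj u (k%:C * cis s) = k * cos (s - u).
Proof. by rewrite prjZ /prj /= cosB; ring. Qed.

(* The chord at angle [t] has half-length [W]; its end points lie on the circle
   of radius [rho], at angles [t + d] and [t - d], [d = atan (W / r)]. *)
Variables (rho r W : R).
Hypothesis r_gt0 : 0 < r.
Hypothesis rho_gt0 : 0 < rho.
Hypothesis W_gt0 : 0 < W.
Hypothesis rhoE : rho ^+ 2 = r ^+ 2 + W ^+ 2.

Let d : R := atan (W / r).

Let d_bounds : 0 <= d <= pi.
Proof.
have p := pi_gt0 R; apply/andP; split.
  by rewrite -atan0; apply/ltW/lt_atan/divr_gt0.
by have := atan_ltpi2 (W / r); rewrite -/d; lra.
Qed.

Lemma half_angle : r +i* W = rho%:C * cis d.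
Proof.
have := ph_polar (ph_atan W r_gt0).
by rewrite (@normc_sqrt_eq _ rho) //=; exact: ltW.
Qed.

Let cos_d : rho * cos d = r.
Proof.
by have := congr1 Re half_angle; rewrite ReM /= mul0r subr0 => ->.
Qed.

Let sin_d : rho * sin d = W.
Proof.
by have := congr1 Im half_angle; rewrite ImM /= mul0r addr0 => ->.
Qed.

Lemma chord_end_right t : chord t r W = rho%:C * cis (t + d).
Proof. by rewrite /chord half_angle mulrCA -cisD. Qed.

Lemma chord_end_left t : chord t r (- W) = rho%:C * cis (t - d).
Proof.
rewrite /chord; have -> : r +i* - W = rho%:C * cis (- d).
  by apply: eqC; rewrite ?ReM ?ImM /= mul0r ?subr0 ?addr0 ?cosN ?sinN ?mulrN ?cos_d ?sin_d.
by rewrite mulrCA -cisD.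
Qed.

Lemma rho_bounds : r <= rho <= r + W.
Proof.
have [r0 W0 rho0] : [/\ 0 <= r, 0 <= W & 0 <= rho] by split; exact: ltW.
apply/andP; split; rewrite -(@ler_pXn2r _ 2) ?nnegrE ?addr_ge0 // rhoE.
  by rewrite lerDl sqr_ge0.
by rewrite sqrrD lerD2r lerDl mulrn_wge0 // mulr_ge0.
Qed.

Variable ts : seq R.
Hypothesis ts_path : path <%R (- pi) ts.
Hypothesis ts_last : last (- pi) ts = pi.
(** [- pi] opens the turn and gives the same direction as [pi]; the case [cos (u - t) = 1] of [gap]
    covers this coincidence as well as [u = t]. *)
Let all_ts := - pi :: ts.

Hypothesis gap : forall t u, t \in all_ts -> u \in ts ->
  cos (u - t) = 1 \/ W <= r * (1 - cos (u - t)).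
Hypothesis sep : forall t t', t \in all_ts -> t' \in all_ts -> t < t' ->
  d *+ 2 <= t' - t.

Lemma angles_bounds t : t \in ts -> - pi < t <= pi.
Proof.
move=> tts; have /andP[-> _] : (- pi < t) && true.
  rewrite andbT; have := order_path_min lt_trans ts_path.
  by move=> /allP /(_ t tts).
have := ts_path; case/splitPr: tts ts_last => p1 p2; rewrite last_cat /= => <-.
rewrite cat_path /= => /and3P[_ _ h].
have := order_path_min lt_trans h => /allP H.
by have := mem_last t p2; rewrite inE => /orP[/eqP e|/H /ltW //]; rewrite e.
Qed.

Lemma pi_in_ts : pi \in ts.
Proof.
have := mem_last (- pi) ts; rewrite ts_last inE => /orP[/eqP h|//].
by have := pi_gt0 R; rewrite h; lra.
Qed.

Lemma all_ts_bounds t : t \in all_ts -> - pi <= t <= pi.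
Proof.
rewrite inE => /orP[/eqP ->|/angles_bounds /andP[h ->]]; last by rewrite ltW.
by have := pi_ge0 R; rewrite lexx; lra.
Qed.

(** For another direction [u] the projection on the chord is at most [r * cos (u - t) + W], which
    [gap] bounds by [r]: no other cap cuts into the chord. *)
Lemma chord_on_circle t s : t \in all_ts -> - W <= s <= W ->
  cut_circle ts rho r (chord t r s).
Proof.
move=> tts /andP[s1 s2]; split.
  split.
    rewrite normc_chord -[rho]gtr0_norm // -sqrtr_sqr ler_sqrt ?sqr_ge0 //.
    rewrite rhoE lerD2l -[s ^+ 2]real_normK ?num_real //.
    by rewrite lerXn2r ?nnegrE ?normr_ge0 ?(ltW W_gt0) // ler_norml s1.
  move=> u uts; rewrite prj_chord; have [c1|cW] := gap tts uts.
    have s0 : sin (u - t) = 0.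
      have := cos2Dsin2 (u - t); rewrite c1 expr1n => e.
      have /eqP : sin (u - t) ^+ 2 = 0 by lra.
      by rewrite expf_eq0 /= => /eqP.
    by rewrite c1 s0 mulr1 mulr0 addr0.
  have : s * sin (u - t) <= W.
    apply: le_trans (ler_norm _) _; rewrite normrM -[W]mulr1.
    by rewrite ler_pM ?normr_ge0 // ?sin_max // ler_norml s1.
  by move: cW; rewrite mulrBr mulr1; lra.
right; have [tp|tp] := eqVneq t (- pi).
  exists pi; first exact: pi_in_ts.
  rewrite prj_chord tp opprK -mulr2n -[pi *+ 2]add0r cosD2pi sinD2pi cos0 sin0.
  by rewrite mulr1 mulr0 addr0.
exists t; first by move: tts; rewrite inE (negPf tp).
by rewrite prj_chord subrr cos0 sin0 mulr1 mulr0 addr0.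
Qed.

Definition consecutive t t' :=
  [/\ t \in all_ts, t' \in ts, t < t' & forall u, u \in ts -> ~ (t < u < t')].

(** Since [r = rho * cos d], the cap at [u] removes from the circle just the points at angular
    distance less than [d] from [u]. *)
Lemma arc_on_circle t t' s : consecutive t t' -> t + d <= s <= t' - d ->
  cut_circle ts rho r (rho%:C * cis s).
Proof.
move=> [tts t'ts tt' tcons] /andP[s1 s2].
have nrm : normc (rho%:C * cis s) = rho.
  by rewrite Normc.normcM normc_cis mulr1 normc_real ger0_norm // ltW.
split; last by left.
split; first by rewrite nrm.
move=> u uts; rewrite prj_cis -cos_d ler_pM2l //.
have /andP[d0 _] := d_bounds.
apply: cos_le_away => //.
have /andP[u1 u2] := angles_bounds uts.
have /andP[t1 _] := all_ts_bounds tts.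
have /andP[_ t'2] := angles_bounds t'ts.
rewrite mulr2n; have [ut|tu] := leP u t.
  rewrite ger0_norm; last by lra.
  by apply/andP; split; lra.
have t'u : t' <= u.
  by rewrite leNgt; apply/negP => ut'; apply: (tcons u uts); rewrite tu.
rewrite ler0_norm; last by lra.
by apply/andP; split; lra.
Qed.

Variables (L : {fset R[i]}) (c : R[i] -> R[i]).
Hypothesis L_neq0 : L != fset0.
Hypothesis c_neq0 : forall l, l \in L -> c l != 0.
Hypothesis ties : forall l l', l \in L -> l' \in L -> l != l' ->
  forall x : R, - pi < x <= pi -> prj x (l - l') = 0 -> x \in ts.
Hypothesis dominant : forall v, v \in L ->
  \sum_(l <- L | l != v) normc (c l / c v) * expR (- (W * normc (v - l))) < 1.

Lemma consecutive_no_ties t t' : consecutive t t' -> no_ties L t t'.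
Proof.
move=> [tts t'ts tt' tcons] l l' lL l'L ll' x /andP[tx xt'].
apply/eqP => p0; apply: (tcons x); last by rewrite tx.
apply: (ties lL l'L ll') => //.
have /andP[t1 _] := all_ts_bounds tts.
have /andP[_ t'2] := angles_bounds t'ts.
by apply/andP; split; lra.
Qed.

(* On the arc between two cut-off caps the vertex [v] beats every other [l] by
   a margin, since its projection does so weakly at angular distance [d]. *)
Lemma arc_margin t t' s l : consecutive t t' -> t + d <= s <= t' - d ->
  l \in L -> l != vtx L 1 t ->
  Re ((l - vtx L 1 t)^* * (rho%:C * cis s)) <= - (W * normc (vtx L 1 t - l)).
Proof.
move=> tc /andP[s1 s2] lL lv; set v := vtx L 1 t; set w := v - l.
have [tts t'ts tt' tcons] := tc.
have [pos nneg] := vtx_arc L_neq0 tt' (consecutive_no_ties tc) lL lv.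
rewrite -/v -/w in pos nneg.
have /andP[d0 _] := d_bounds.
have -> : Re ((l - v)^* * (rho%:C * cis s)) = - (rho * prj s w).
  have -> : w = - (l - v) by rewrite opprB.
  rewrite prjN mulrN opprK /prj; case: (l - v) => x y.
  by rewrite !(ReM, ImM) /= mul0r; ring.
rewrite lerN2.
have A0 : 0 <= prj s w by apply: nneg; apply/andP; split; lra.
(* For the coordinates [A], [B] of [w] along and across [s], weak dominance at [s + d] and [s - d]
   says that [W * B] is at most [r * A] in size; with [rho ^+ 2 = r ^+ 2 + W ^+ 2] this gives
   [W * normc w <= rho * A]. *)
have P1 : 0 <= prj (s + d) w by apply: nneg; apply/andP; split; lra.
have P2 : 0 <= prj (s - d) w by apply: nneg; apply/andP; split; lra.
have := mulr_ge0 (ltW rho_gt0) P1; have := mulr_ge0 (ltW rho_gt0) P2.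
rewrite (prj_rot s (s - d)) (prj_rot s (s + d)).
rewrite addrAC subrr add0r addrAC subrr add0r cosN sinN.
have := prj_sqr s w; move: A0; move: (prj s w) (oprj s w) => A B A0.
set n := normc w => e.
rewrite !mulrDr ![rho * (_ * _)]mulrA mulrN cos_d sin_d => h1 h2.
have n0 : 0 <= n by exact: normc_ge0.
have Wn : 0 <= W * n by rewrite mulr_ge0 // ltW.
have rA : 0 <= rho * A by rewrite mulr_ge0 // ltW.
rewrite -(@ler_pXn2r _ 2) ?nnegrE //.
rewrite !exprMn -e rhoE.
have : (W * B) ^+ 2 <= (r * A) ^+ 2.
  rewrite -[X in X <= _]real_normK ?num_real // lerXn2r ?nnegrE ?normr_ge0 //.
    by rewrite mulr_ge0 // ltW.
  by rewrite ler_norml; apply/andP; split; lra.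
by rewrite !exprMn mulrDr mulrDl; lra.
Qed.

Variables (N : nat) (G : R[i] -> R).
Hypothesis AG : arg_rest L c ts rho r N G.
Variable M : R.
Hypothesis chordM : forall t a b, t \in all_ts -> a <= b -> b - a <= W ->
  (forall s, a <= s <= b -> cut_circle ts rho r (chord t r s)) ->
  `|N%:R * (atan (b / r) - atan (a / r)) + (G (chord t r b) - G (chord t r a))| <= M.

Let S := \sum_(l <- L) normc l.

(** Half a chord, an arc, half a chord, with the same vertex at both ends by [vtx_before]. The bound
    adds [M] per half-chord, [pi *+ 2] for the arc, and [(W * S) *+ 2] for replacing each arc end by
    [rho * cis] of the nearby direction. *)
Lemma step_change t t' : consecutive t t' ->
  `|N%:R * (t' - t) + (G (chord t' r 0) - G (chord t r 0))
    - rho * (Im ((vtx L (-1) t')^* * cis t') - Im ((vtx L 1 t)^* * cis t))|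
  <= M *+ 2 + pi *+ 2 + (W * S) *+ 4.
Proof.
move=> tc; have [tts t'ts tt' tcons] := tc.
have t'all : t' \in all_ts by rewrite inE t'ts orbT.
rewrite (vtx_before L_neq0 tt' (consecutive_no_ties tc)).
set v := vtx L 1 t.
have [vL _] := vtxP L_neq0 t (oner_neq0 R).
have W0 := ltW W_gt0.
have h1 : `|N%:R * (atan (W / r) - atan (0 / r))
    + (G (chord t r W) - G (chord t r 0))| <= M.
  apply: chordM => // [|s /andP[s0 sW]]; first by rewrite subr0.
  by apply: chord_on_circle => //; rewrite sW (le_trans _ s0) // oppr_le0.
have h3 : `|N%:R * (atan (0 / r) - atan (- W / r))
    + (G (chord t' r 0) - G (chord t' r (- W)))| <= M.
  apply: chordM => // [||s /andP[s0 sW]]; first by rewrite oppr_le0.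
    by rewrite sub0r opprK.
  by apply: chord_on_circle => //; rewrite s0 (le_trans sW).
have dd := sep tts t'all tt'.
have h2 := @arc_change R L c ts rho r N G v (t + d) (t' - d) AG rho_gt0 vL
  (c_neq0 vL) _ (fun s => @arc_on_circle t t' s tc).
have {}h2 : `|N%:R * (t' - d - (t + d)) + (G (rho%:C * cis (t' - d)) -
    G (rho%:C * cis (t + d))) - (Im (v^* * (rho%:C * cis (t' - d))) -
    Im (v^* * (rho%:C * cis (t + d))))| <= pi *+ 2.
  apply: h2 => [|s sb]; first by move: dd; rewrite mulr2n; lra.
  apply: le_lt_trans (dominant vL).
  rewrite big_seq_cond [X in _ <= X]big_seq_cond.
  apply: ler_sum => l /andP[lL lv]; apply: ler_wpM2l; first exact: normc_ge0.
  by rewrite ler_expR; exact: (arc_margin tc sb lL lv).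
have at0 : atan (0 / r) = 0 by rewrite mul0r atan0.
have atN : atan (- W / r) = - d by rewrite mulNr atanN.
rewrite chord_end_right at0 subr0 -/d in h1.
rewrite chord_end_left at0 atN opprK add0r in h3.
have vS : normc v <= S.
  rewrite /S (big_rem v) //= lerDl; apply: sumr_ge0 => l _; exact: normc_ge0.
have S0 : 0 <= S by apply: le_trans vS; exact: normc_ge0.
have /andP[rr1 rr2] := rho_bounds.
(* The chord end is within [(rho - r) + W <= 2 W] of [rho * cis u], and [normc v <= S]. *)
have near (u e : R) : `|e| = W ->
   `|Im (v^* * chord u r e) - rho * Im (v^* * cis u)| <= (W * S) *+ 2.
  move=> eW.
  have -> : rho * Im (v^* * cis u) = Im (v^* * (rho%:C * cis u)).
    by rewrite !(ImM, ReM) /= mul0r; ring.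
  rewrite -ImN -ImD -mulrBr; apply: le_trans (ler_Im_normc _) _.
  have -> : chord u r e - rho%:C * cis u = cis u * ((r - rho) +i* e).
    by apply: eqC; rewrite /chord !(ImD, ReD, ReN, ImN, ImM, ReM) /=; ring.
  rewrite !Normc.normcM normc_cis mul1r normc_conj mulrC -mulrnAl.
  apply: ler_pM; rewrite ?normc_ge0 //.
  apply: le_trans (ler_normc_ReIm _) _; rewrite /= eW mulr2n lerD2r.
  by rewrite ler0_norm; lra.
have := near t W (ger0_norm W0); rewrite chord_end_right.
have := near t' (- W) (ltac:(by rewrite normrN ger0_norm)); rewrite chord_end_left.
move: h1 h2 h3; rewrite !ler_norml !mulr2n !mulrS !mulr0n !addr0.
set X1 := G _; set X2 := G _; set X3 := G _; set X4 := G _.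
set Y1 := Im _; set Y2 := Im _; set Y3 := Im _; set Y4 := Im _.
rewrite (_ : N%:R * (t' - d - (t + d)) = N%:R * (t' - t) - N%:R * d - N%:R * d);
  last by ring.
set Z := N%:R * d; set V := N%:R * (t' - t); set T := W * S.
move=> /andP[? ?] /andP[? ?] /andP[? ?] /andP[? ?] /andP[? ?].
by apply/andP; split; lra.
Qed.

(** Summation by parts: the terms [P y - Q x] over consecutive nodes regroup into jumps [P y - Q y]
    at single nodes and one boundary term in [Q]. *)
Lemma path_telescope (F P Q : R -> R) (C x0 : R) (s : seq R) : path <%R x0 s ->
  (forall x y, x \in x0 :: s -> y \in s -> x < y ->
     (forall u, u \in s -> ~ (x < u < y)) -> `|F y - F x - (P y - Q x)| <= C) ->
  `|F (last x0 s) - F x0 - (\sum_(y <- s) (P y - Q y) + (Q (last x0 s) - Q x0))|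
    <= C *+ size s.
Proof.
elim: s x0 => [|y s IH] x0 /=; first by rewrite big_nil !subrr addr0 subr0 normr0.
move=> /andP[xy ps] H.
have gt_y u : u \in s -> y < u.
  by move=> us; have /allP := order_path_min lt_trans ps; exact.
have h1 := IH y ps (fun a b ha hb ab hu => ltac:(apply: H => //;
  [by rewrite in_cons ha orbT|by rewrite in_cons hb orbT|
   move=> u; rewrite in_cons => /orP[/eqP ->|/hu//] /andP[ay _];
   move: ha; rewrite in_cons => /orP[/eqP e|/gt_y];
     [by rewrite e ltxx in ay|by move/(lt_trans ay); rewrite ltxx]])).
have h2 := H x0 y (mem_head _ _) (mem_head _ _) xy (fun u => ltac:(
  rewrite in_cons => /orP[/eqP ->|/gt_y yu] /andP[_ uy];
  [by rewrite ltxx in uy|by move: (lt_trans yu uy); rewrite ltxx])).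
rewrite big_cons mulrS.
rewrite (_ : _ - _ = (F y - F x0 - (P y - Q x0)) + (F (last y s) - F y -
  (\sum_(z <- s) (P z - Q z) + (Q (last y s) - Q y)))); last by ring.
by rewrite (le_trans (ler_normD _ _)) // lerD.
Qed.

Lemma vtx_2pi s t : s != 0 -> vtx L s (t + pi *+ 2) = vtx L s t.
Proof.
move=> s0; apply: vtx_eq => //; have [vL vP] := vtxP L_neq0 t s0.
split=> // l lL lv; have := vP l lL lv.
by rewrite /lexpos /prj /oprj cosD2pi sinD2pi.
Qed.

(** [Im (v^* * cis t)] is [- oprj t v], and the side is perpendicular to [cis t], so the jump
    between its ends is its whole length. *)
Lemma side_phase t :
  Im ((vtx L (-1) t)^* * cis t) - Im ((vtx L 1 t)^* * cis t) =
  normc (vtx L 1 t - vtx L (-1) t).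
Proof.
have m1 : (-1 : R) != 0 by rewrite oppr_eq0 oner_eq0.
have qP := vtxP L_neq0 t (oner_neq0 R); have pP := vtxP L_neq0 t m1.
set q := vtx L 1 t in qP *; set p := vtx L (-1) t in pP *.
have p0 : prj t (q - p) = 0.
  rewrite prjB; apply/eqP; rewrite subr_eq0 eq_le.
  by rewrite (prj_ge_vtx pP (proj1 qP)) (prj_ge_vtx qP (proj1 pP)).
have o0 : 0 <= oprj t (q - p).
  have [->|pq] := eqVneq p q; first by rewrite subrr /oprj /= !mul0r subrr.
  have [|[_]] := (proj2 qP) p (proj1 pP) pq; first by rewrite p0 ltxx.
  by rewrite mul1r => /ltW.
transitivity (oprj t (q - p)).
  by rewrite /oprj !(ImD, ReD, ImN, ReN, ImM, ReM); case: q p {qP pP p0 o0} => ? ? [? ?] /=; ring.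
apply/esym/normc_sqrt_eq => //.
by rewrite -normc_sqr -(prj_sqr t) p0 expr0n add0r.
Qed.

(** After a full turn [G] and [Q] return to their initial values; only [N] times [pi *+ 2] and the
    jumps remain. *)
Lemma boundary_total :
  `|N%:R * (pi *+ 2) - rho * \sum_(t <- ts) normc (vtx L 1 t - vtx L (-1) t)|
  <= (M *+ 2 + pi *+ 2 + (W * S) *+ 4) *+ size ts.
Proof.
pose F t := N%:R * t + G (chord t r 0).
pose P t := rho * Im ((vtx L (-1) t)^* * cis t).
pose Q t := rho * Im ((vtx L 1 t)^* * cis t).
have pp : pi = - pi + pi *+ 2 :> R by rewrite mulr2n addKr.
have cp : cis pi = cis (- pi) :> R[i] by rewrite [in LHS]pp cis2pi.
have Qp : Q pi = Q (- pi) by rewrite /Q cp [X in vtx L 1 X]pp vtx_2pi ?oner_neq0.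
have := @path_telescope F P Q (M *+ 2 + pi *+ 2 + (W * S) *+ 4) _ _ ts_path.
rewrite ts_last Qp subrr addr0.
rewrite (_ : F pi - F (- pi) = N%:R * (pi *+ 2)); last first.
  by rewrite /F /chord cp mulr2n; ring.
rewrite (_ : \sum_(y <- ts) (P y - Q y) =
   rho * \sum_(t <- ts) normc (vtx L 1 t - vtx L (-1) t)); last first.
  by rewrite mulr_sumr; apply: eq_bigr => t _; rewrite /P /Q -mulrBr side_phase.
apply => x y xs ys xy hu.
rewrite (_ : F y - F x - (P y - Q x) = N%:R * (y - x) +
  (G (chord y r 0) - G (chord x r 0)) - rho * (Im ((vtx L (-1) y)^* * cis y) -
  Im ((vtx L 1 x)^* * cis x))); last by rewrite /F /P /Q; ring.
exact: step_change.
Qed.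

End BoundaryTotal.

(** * Choice of the constants and zero count in cut discs *)

Section CutDiscCount.
Variable R : realType.
Local Notation normc := (@Normc.normc R).

Lemma expR_decay (k e d : R) : 0 <= k -> 0 < e -> 0 < d ->
  exists W, forall W', W <= W' -> k * expR (- (W' * d)) <= e.
Proof.
move=> k0 e0 d0; exists (k / e / d) => W' WW'.
have h : k / e <= W' * d by rewrite -ler_pdivrMr.
have ke : 0 <= k / e by rewrite divr_ge0 // ltW.
have h1 : 1 + k / e <= expR (W' * d).
  by apply: le_trans (expR_ge1Dx _); rewrite lerD2l.
rewrite expRN ler_pdivrMr ?expR_gt0 //.
apply: le_trans (_ : e * (1 + k / e) <= _); last by rewrite ler_pM2l.
by rewrite mulrDr mulr1 mulrCA divff ?gt_eqF // mulr1 lerDr ltW.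
Qed.

Lemma exists_dominant_width (L : {fset R[i]}) (c : R[i] -> R[i]) :
  exists2 W : R, 0 < W & forall v, v \in L ->
    \sum_(l <- L | l != v) normc (c l / c v) * expR (- (W * normc (v - l))) < 1.
Proof.
pose n := size (enum_fset L).
(* A share of [1 / (n + 1)] for each of at most [n] terms keeps the sum below 1. *)
pose e : R := n.+1%:R^-1.
have e0 : 0 < e by rewrite invr_gt0.
have [W HW] : exists W : R, forall v, v \in enum_fset L -> forall W', W <= W' ->
   forall l, l \in enum_fset L -> l != v ->
   normc (c l / c v) * expR (- (W' * normc (v - l))) <= e.
  apply: exists_uniform => [v M M' MM' H W' h|v vL]; first by apply: H; exact: le_trans h.
  have [W HW] : exists W : R, forall l, l \in enum_fset L -> forall W', W <= W' ->
     l != v -> normc (c l / c v) * expR (- (W' * normc (v - l))) <= e.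
    apply: exists_uniform => [l M M' MM' H W' h|l lL].
      by apply: H; exact: le_trans h.
    have [->|lv] := eqVneq l v; first by exists 0 => W' _; rewrite ?eqxx.
    have [|W HW] := @expR_decay (normc (c l / c v)) e (normc (v - l)) (normc_ge0 _) e0.
      by rewrite normc_gt0 subr_eq0 eq_sym.
    by exists W => W' /HW.
  by exists W => W' WW' l lL; apply: HW.
exists (Num.max W 1); first by rewrite lt_max ltr01 orbT.
move=> v vL; apply: le_lt_trans (_ : \sum_(l <- enum_fset L) e < 1).
  rewrite big_mkcond /= big_seq [X in _ <= X]big_seq; apply: ler_sum => l lL.
  case: ifPn => lv; last exact: ltW.
  by apply: HW => //; rewrite le_max lexx.
rewrite big_const_seq count_predT iter_addr addr0 -mulr_natl.
by rewrite ltr_pdivrMr // mul1r ltr_nat.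
Qed.

Lemma exists_gap_threshold (W x : R) : 0 < W -> exists r0, forall r, r0 <= r ->
  cos x = 1 \/ W <= r * (1 - cos x).
Proof.
move=> W0; have [c1|c1] := eqVneq (cos x) 1; first by exists 0 => r _; left.
have c0 : 0 < 1 - cos x by rewrite subr_gt0 lt_neqAle c1 cos_le1.
by exists (W / (1 - cos x)) => r h; right; rewrite -ler_pdivrMr.
Qed.

Lemma exists_sep_threshold (W x : R) : 0 < W -> 0 < x -> exists r0, forall r, r0 <= r ->
  atan (W / r) *+ 2 <= x.
Proof.
move=> W0 x0; have p := pi_gt0 R.
pose y : R := Num.min (x / 2) (pi / 4).
have y0 : 0 < y by rewrite lt_min !divr_gt0.
have yx : y <= x / 2 by rewrite ge_min lexx.
have yp : y < pi / 2.
  by apply: le_lt_trans (_ : pi / 4 < _); rewrite ?ge_min ?lexx ?orbT //; lra.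
have ty : 0 < tan y by rewrite divr_gt0 ?sin_gt0_pi ?cos_gt0_pihalf //; apply/andP; split; lra.
exists (W / tan y) => r h.
have r0 : 0 < r by apply: lt_le_trans h; exact: divr_gt0.
have : atan (W / r) <= y.
  rewrite -[leRHS](@tanK _ y); last by rewrite in_itv /=; apply/andP; split; lra.
  by apply: le_atan; rewrite ler_pdivrMr // mulrC -ler_pdivrMr.
by rewrite mulr2n; lra.
Qed.

(** [ts], [W] and [C] are fixed before [rho], which is the uniformity behind the final bounded
    error. The choice of [r] gives every chord the half-length [W]. *)
Lemma count_zeros_cut_disc (L : {fset R[i]}) (c : R[i] -> R[i])
    (L_neq0 : L != fset0) (c_neq0 : forall l, l \in L -> c l != 0) :
  exists (ts : seq R) (W C rho0 : R),
  [/\ path <%R (- pi) ts, last (- pi) ts = pi,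
    (forall l l', l \in L -> l' \in L -> l != l' -> forall x : R, - pi < x <= pi ->
     prj x (l - l') = 0 -> x \in ts),
    0 < W & forall rho, rho0 <= rho ->
      let r := Num.sqrt (rho ^+ 2 - W ^+ 2) in
      [/\ rho - W <= r, 0 < r &
      (forall z, cut_circle ts rho r z -> expsum L c z != 0) ->
      forall zs : seq R[i], uniq zs ->
      (forall z, z \in zs <-> cut_disc ts rho r z /\ expsum L c z = 0) ->
      `|(\sum_(a <- zs) ord L_neq0 c_neq0 a)%:R * (pi *+ 2)
        - rho * \sum_(t <- ts) normc (vtx L 1 t - vtx L (-1) t)| <= C]].
Proof.
have [ts [ts_path ts_last ties]] := exists_angles L.
have [W W0 dom] := exists_dominant_width L c.
pose all_ts := - pi :: ts.
have [r1 H1] : exists r1 : R, forall t, t \in all_ts -> forall r, r1 <= r ->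
   forall u, u \in ts -> cos (u - t) = 1 \/ W <= r * (1 - cos (u - t)).
  apply: exists_uniform => [t M M' MM' H r h|t tts]; first by apply: H; exact: le_trans h.
  have [r1 H1] : exists r1 : R, forall u, u \in ts -> forall r, r1 <= r ->
     cos (u - t) = 1 \/ W <= r * (1 - cos (u - t)).
    apply: exists_uniform => [u M M' MM' H r h|u uts].
      by apply: H; exact: le_trans h.
    exact: exists_gap_threshold.
  by exists r1 => r rr u uts; apply: H1.
have [r2 H2] : exists r2 : R, forall t, t \in all_ts -> forall r, r2 <= r ->
   forall u, u \in all_ts -> t < u -> atan (W / r) *+ 2 <= u - t.
  apply: exists_uniform => [t M M' MM' H r h|t tts]; first by apply: H; exact: le_trans h.
  have [r2 H2] : exists r2 : R, forall u, u \in all_ts -> forall r, r2 <= r ->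
     t < u -> atan (W / r) *+ 2 <= u - t.
    apply: exists_uniform => [u M M' MM' H r h|u uts].
      by apply: H; exact: le_trans h.
    have [tu|ut] := ltP t u; last by exists 0 => r _.
    have [|r0 Hr0] := @exists_sep_threshold W (u - t) W0; first by rewrite subr_gt0.
    by exists r0 => r /Hr0.
  by exists r2 => r rr u uts; apply: H2.
have [M HM] : exists M, forall t, t \in all_ts -> forall c ts rho r N G a b,
  arg_rest L c ts rho r N G -> 0 < r -> a <= b -> b - a <= W ->
  (forall s, a <= s <= b -> cut_circle ts rho r (chord t r s)) ->
  `|N%:R * (atan (b / r) - atan (a / r)) + (G (chord t r b) - G (chord t r a))| <= M.
  apply: exists_uniform => [t M M' MM' H c' ts' rho r N G a b h1 h2 h3 h4 h5|t _].
    by apply: le_trans MM'; exact: (H c' ts' rho r N G a b h1 h2 h3 h4 h5).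
  by have [M HM] := chord_change L t W; exists M.
pose S := \sum_(l <- L) normc l.
(* As [r >= rho - W], this threshold for [rho] puts [r] above [r1] and [r2] and makes it
   positive. *)
exists ts, W, ((M *+ 2 + pi *+ 2 + (W * S) *+ 4) *+ size ts),
  (W + 1 + Num.max 0 (Num.max r1 r2)); split => // rho rhoW /=.
set mx := Num.max 0 _ in rhoW.
have mx0 : 0 <= mx by rewrite le_max lexx.
have mx1 : r1 <= mx by rewrite !le_max lexx orbT.
have mx2 : r2 <= mx by rewrite !le_max lexx !orbT.
set r := Num.sqrt _.
have W2 : 0 <= rho ^+ 2 - W ^+ 2.
  by rewrite subr_ge0 lerXn2r ?nnegrE; lra.
have rE : rho ^+ 2 = r ^+ 2 + W ^+ 2 by rewrite sqr_sqrtr // subrK.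
have rW : rho - W <= r.
  rewrite -[leLHS]ger0_norm; last lra.
  rewrite -sqrtr_sqr ler_sqrt // sqrrB mulr2n.
  have : W * W <= rho * W by rewrite ler_pM2r //; lra.
  by rewrite -expr2; lra.
have r0 : 0 < r by lra.
have rho0 : 0 < rho by lra.
split => // fn0 zs uzs zsP.
have [G AG] := argument_principle r0 rho0 L_neq0 c_neq0 fn0 uzs zsP.
apply: (@boundary_total R rho r W r0 rho0 W0 rE ts ts_path ts_last _ _ L c L_neq0
  c_neq0 ties dom _ G AG M).
- by move=> t u tts uts; apply: H1 => //; lra.
- by move=> t u tts uts tu; apply: (H2 t) => //; lra.
- by move=> t a b tts ab bW bd; apply: (HM t tts c ts rho r _ G).
Qed.

End CutDiscCount.

(** * Sides and perimeter of the Newton polygon *)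

Section Perimeter.
Variable R : realType.
Local Notation normc := (@Normc.normc R).
Local Notation Re := (@complex.Re R).
Local Notation Im := (@complex.Im R).
Local Open Scope convex_scope.

Lemma convE (x y : plane R) (t : {i01 R}) :
  (x <| t |> y : R[i]) = t%:num%:C * (x : R[i]) + (1 - t%:num)%:C * (y : R[i]).
Proof. by case: x y => a b [a' b']; apply: eqC => /=; rewrite /unstable.onem; ring. Qed.

Lemma prj_conv u (x y : plane R) (t : {i01 R}) :
  prj u (x <| t |> y : R[i]) = t%:num * prj u x + (1 - t%:num) * prj u y.
Proof. by rewrite convE prjD !prjZ. Qed.

Lemma i01_bounds (t : {i01 R}) : 0 <= t%:num <= 1.
Proof. by rewrite ge0 le1. Qed.

Lemma lexposZ s t (k : R) (w : R[i]) : 0 < k -> lexpos s t w -> lexpos s t (k%:C * w).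
Proof.
move=> k0; rewrite /lexpos prjZ => -[h|[h h']]; first by left; exact: mulr_gt0.
right; split; first by rewrite h mulr0.
have -> : oprj t (k%:C * w) = k * oprj t w by rewrite /oprj ReM ImM /= !mul0r; ring.
by rewrite mulrCA mulr_gt0.
Qed.

Lemma lexpos0 s t : ~ lexpos s t (0 : R[i]).
Proof. by move=> h; apply: (lexpos_irr h); rewrite oppr0. Qed.

Lemma cis_inj (t t' : R) : - pi < t <= pi -> - pi < t' <= pi ->
  cis t = cis t' -> t = t'.
Proof.
have main (a b : R) : - pi < a -> a <= b -> b <= pi -> cis a = cis b -> a = b.
  move=> pa ab bp e; have [h|h] := leP (b - a) pi.
    have := @cis_eq1_small _ a (b - a).
    rewrite subr_ge0 ab h [a + _](_ : _ = b); last by ring.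
    rewrite e.
    by move=> /(_ isT erefl); lra.
  have := @cis_eq1_small _ b (a + pi *+ 2 - b).
  rewrite [b + _](_ : _ = a + pi *+ 2); last by ring.
  rewrite cis2pi e mulr2n => /(_ _ erefl) h'.
  have : a + (pi + pi) - b = 0 by apply: h'; apply/andP; split; lra.
  lra.
move=> /andP[h1 h2] /andP[h3 h4] e; have [tt'|/ltW t't] := leP t t'.
  exact: main.
by apply/esym/main.
Qed.

(** [t] is an argument of [-i * w], the outer normal of a side run counterclockwise; the value
    [- pi] is replaced by [pi]. *)
Lemma polar_normal (w : R[i]) : w != 0 -> exists t,
  [/\ - pi < t <= pi, prj t w = 0 & 0 < oprj t w].
Proof.
move=> w0; have v0 : w * (0 -i* 1) != 0.
  by rewrite mulf_neq0 // eq_complex /= oppr_eq0 oner_eq0 andbF.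
have [t [[k k0 e] tp]] := ph_exists_pi v0.
have we : w = k%:C * cis t * (0 +i* 1).
  by rewrite -e; apply: eqC; rewrite !(ReM, ImM) /=; ring.
have h (u : R) : cis u = cis t -> prj u w = 0 /\ 0 < oprj u w.
  move=> [cu su]; rewrite /prj /oprj we !(ReM, ImM) /= cu su; split; first by ring.
  rewrite [X in 0 < X](_ : _ = k * (cos t ^+ 2 + sin t ^+ 2)); last by ring.
  by rewrite cos2Dsin2 mulr1.
move: tp; rewrite ler_norml => /andP[t1 t2].
have [tp|tp] := eqVneq t (- pi).
  have [|h1 h2] := h pi; first by rewrite tp -(cis2pi (- pi)) mulr2n addKr.
  by exists pi; split => //; rewrite lexx andbT gtrN // pi_gt0.
by have [//|h1 h2] := h t; exists t; split; rewrite ?t2 ?andbT // lt_neqAle eq_sym tp.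
Qed.

Variable L : {fset R[i]}.
Hypothesis L_neq0 : L != fset0.
Let D : set (plane R) := newton_polygon L.

Lemma polygon_vertices l : l \in L -> D l.
Proof. by move=> lL A [_]; apply. Qed.

Lemma polygon_convex : @convex_set R (Rcomplex R) D.
Proof.
move=> x y t; rewrite !inE => Dx Dy A [cA LA].
by apply/set_mem/cA; rewrite inE; [apply: Dx|apply: Dy].
Qed.

Lemma polygon_sub (A : set (plane R)) : @convex_set R (Rcomplex R) A ->
  (forall l : R[i], l \in L -> A l) -> (D `<=` A)%classic.
Proof. by move=> cA LA; apply: smallest_sub. Qed.

(** A convex set without one of its extreme points is still convex; if [p] were outside [L], this
    smaller set would contain [L], against minimality of the hull. *)
Lemma extreme_in_L (p : plane R) : extreme_point D p -> (p : R[i]) \in L.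
Proof.
move=> [Dp pP]; apply/negPn/negP => pL.
have : (D `\ p)%classic p; last by move=> [_]; apply.
apply: (@polygon_sub (D `\ p)%classic) => //; last first.
  move=> l lL; split; first exact: polygon_vertices.
  by move=> lp; move: pL; rewrite -lp lL.
move=> x y t; rewrite !inE => -[Dx xp] [Dy yp]; split.
  by apply/set_mem/polygon_convex; rewrite inE.
move=> e; have := pP x y t Dx Dy.
have [t0|t0] := eqVneq (t%:num : R) 0.
  have t0' : t = 0%:i01 by apply/val_inj.
  by move: e; rewrite t0' conv0.
have [t1|t1] := eqVneq (t%:num : R) 1.
  have t1' : t = 1%:i01 by apply/val_inj.
  by move: e; rewrite t1' conv1.
have /andP[h0 h1] := i01_bounds t.
by move=> /(_ _ (esym e)) []; first by rewrite !lt_neqAle eq_sym t0 h0 t1 h1.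
Qed.

Lemma polygon_halfplane s t z : s != 0 -> D z -> prj t z <= prj t (vtx L s t).
Proof.
move=> s0 Dz.
suff : (D `<=` [set z : plane R | prj t z <= prj t (vtx L s t)])%classic by apply.
apply: polygon_sub => [x y u|l lL] /=; last exact: (prj_ge_vtx (vtxP L_neq0 t s0)).
rewrite !inE /= => hx hy; rewrite prj_conv; have /andP[u0 u1] := i01_bounds u.
move: (prj t (vtx L s t)) => k in hx hy *.
rewrite [leRHS](_ : _ = u%:num * k + (1 - u%:num) * k); last by ring.
by apply: lerD; apply: ler_wpM2l => //; rewrite subr_ge0.
Qed.

(** Equality with the vertex or being lexicographically behind it survives convex combinations, so
    it passes from [L] to the hull. *)
Lemma polygon_lex s t (z : plane R) : s != 0 -> D z ->
  (z : R[i]) = vtx L s t \/ lexpos s t (vtx L s t - z).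
Proof.
move=> s0 Dz; set v := vtx L s t.
suff : (D `<=` [set z : plane R | (z : R[i]) = v \/ lexpos s t (v - z)])%classic
  by apply.
apply: polygon_sub => [x y u|l lL] /=; last first.
  have [->|lv] := eqVneq l v; first by left.
  by right; apply: (proj2 (vtxP L_neq0 t s0)).
rewrite !inE /= => hx hy; have /andP[u0 u1] := i01_bounds u.
have := convE x y u; move: (x <| u |> y : R[i]) => w wE.
have e : v - w = u%:num%:C * (v - x) + (1 - u%:num)%:C * (v - y).
  by rewrite wE rmorphB /=; ring.
have [u0'|u0'] := eqVneq (u%:num : R) 0.
  by rewrite wE u0' subr0 mul0r mul1r add0r.
have [u1'|u1'] := eqVneq (u%:num : R) 1.
  by rewrite wE u1' subrr mul0r mul1r addr0.
have up : 0 < (u%:num : R) by rewrite lt_neqAle eq_sym u0'.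
have un : 0 < 1 - (u%:num : R) by rewrite subr_gt0 lt_neqAle u1'.
case: hx => [xv|hx]; case: hy => [yv|hy].
- by left; apply/eqP; rewrite eq_sym -subr_eq0 e xv yv !subrr !mulr0 addr0.
- by right; rewrite e xv subrr mulr0 add0r; exact: lexposZ.
- by right; rewrite e yv subrr mulr0 addr0; exact: lexposZ.
- by right; rewrite e; apply: lexposD; exact: lexposZ.
Qed.

(** A proper convex combination equal to the vertex [v] makes a positive combination of [v - x] and
    [v - y] vanish, whereas positive combinations of lexicographically positive vectors are never
    0. *)
Lemma vtx_extreme s t : s != 0 -> extreme_point D (vtx L s t).
Proof.
move=> s0; have [vL _] := vtxP L_neq0 t s0.
split; first exact: polygon_vertices.
move=> x y u Dx Dy /andP[u0 u1]; rewrite -subr_gt0 in u1.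
set v := vtx L s t => vE.
have e : u%:num%:C * (v - (x : R[i])) + (1 - u%:num)%:C * (v - (y : R[i])) = 0.
  transitivity (v - (u%:num%:C * (x : R[i]) + (1 - u%:num)%:C * (y : R[i]))).
    by rewrite rmorphB /=; ring.
  by rewrite -convE -vE subrr.
have [xv|hx] := polygon_lex t s0 Dx; have [yv|hy] := polygon_lex t s0 Dy => //.
- exfalso; move: e; rewrite xv subrr mulr0 add0r => e.
  by have := lexposZ u1 hy; rewrite e; exact: lexpos0.
- exfalso; move: e; rewrite yv subrr mulr0 addr0 => e.
  by have := lexposZ u0 hx; rewrite e; exact: lexpos0.
- exfalso; have := lexposD (lexposZ u0 hx) (lexposZ u1 hy); rewrite e.
  exact: lexpos0.
Qed.

Lemma Im_conj_prj t (w u : R[i]) :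
  Im (w^* * u) = prj t w * oprj t u - oprj t w * prj t u.
Proof.
rewrite /prj /oprj; case: w u => a b [a' b'] /=.
rewrite -[LHS]mulr1 -(cos2Dsin2 t); ring.
Qed.

Lemma not_extreme_between t (x y z : plane R) : D x -> D z ->
  prj t x = prj t y -> prj t z = prj t y ->
  oprj t x < oprj t y -> oprj t y < oprj t z -> ~ extreme_point D y.
Proof.
move=> Dx Dz px pz xy yz [_ yP].
have xz : 0 < oprj t z - oprj t x by lra.
pose k := (oprj t z - oprj t y) / (oprj t z - oprj t x).
have k0 : 0 < k by rewrite divr_gt0 // subr_gt0.
have k1 : k < 1 by rewrite ltr_pdivrMr // mul1r; lra.
have kk : 0 <= k <= 1 by rewrite !ltW.
pose u : {i01 R} := Itv01 (ltW k0) (ltW k1).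
have := yP x z u Dx Dz; rewrite /= k0 k1 => /(_ isT) h.
have [|xy' _] := h; last by move: xy; rewrite xy' ltxx.
apply/eqP; rewrite -subr_eq0; apply/eqP/(@prj_eq0 _ t).
  rewrite prjD prjN prj_conv px pz /=; ring.
rewrite oprjD oprjN convE oprjD.
have oZ (a : R) (w : R[i]) : oprj t (a%:C * w) = a * oprj t w.
  by rewrite /oprj ReM ImM /= !mul0r; ring.
rewrite !oZ /= /k; field.
by rewrite gt_eqF.
Qed.

Variable ts : seq R.
Hypothesis ts_uniq : uniq ts.
Hypothesis ts_bounds : forall t, t \in ts -> - pi < t <= pi.
Hypothesis ties : forall l l', l \in L -> l' \in L -> l != l' ->
  forall x : R, - pi < x <= pi -> prj x (l - l') = 0 -> x \in ts.

Let q t := vtx L 1 t.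
Let p t := vtx L (-1) t.
Let m1 : (-1 : R) != 0. Proof. by rewrite oppr_eq0 oner_eq0. Qed.

Let prj_qp t : prj t (q t - p t) = 0.
Proof.
have qP := vtxP L_neq0 t (oner_neq0 R); have pP := vtxP L_neq0 t m1.
rewrite prjB; apply/eqP; rewrite subr_eq0 eq_le.
by rewrite (prj_ge_vtx pP (proj1 qP)) (prj_ge_vtx qP (proj1 pP)).
Qed.

Let oprj_qp t : p t != q t -> 0 < oprj t (q t - p t).
Proof.
move=> pq; have [_ qP] := vtxP L_neq0 t (oner_neq0 R); have [pL _] := vtxP L_neq0 t m1.
have [|[_]] := qP (p t) pL pq; first by rewrite prj_qp ltxx.
by rewrite mul1r.
Qed.

Let side t : plane R * plane R := (p t, q t).

(** The outer normal [t] of a side is a tie direction, as both ends lie in [L]. Both ends maximise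
    the projection; an end other than the one-sided maximiser would lie strictly between that
    maximiser and the other end, hence not be extreme. *)
Lemma oriented_sidesE (e : plane R * plane R) :
  oriented_sides D e <-> exists t, [/\ t \in ts, p t != q t & e = side t].
Proof.
split=> [[]|[t [tts pq ->]]]; last first.
  have w0 := oprj_qp pq; split => /=.
  - by apply/eqP.
  - exact: vtx_extreme.
  - by apply: vtx_extreme; exact: oner_neq0.
  - move=> z Dz; rewrite /left_of (Im_conj_prj t) prj_qp mul0r sub0r -mulrN.
    rewrite mulr_ge0 ?(ltW w0) // oppr_ge0 prjB subr_le0.
    exact: polygon_halfplane.
case: e => x y /= xy ex ey left.
have xL := extreme_in_L ex; have yL := extreme_in_L ey.
have [Dx Dy] := (polygon_vertices xL, polygon_vertices yL).
have w0 : (y : R[i]) - x != 0 by rewrite subr_eq0; apply/eqP => e; apply: xy.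
have [t [tb pw ow]] := polar_normal w0.
have tts : t \in ts by apply: (ties yL xL) => //; rewrite -subr_eq0.
have lt_ (z : plane R) : D z -> prj t z <= prj t x.
  move=> /left; rewrite /left_of (Im_conj_prj t) pw mul0r sub0r -mulrN.
  by rewrite pmulr_rge0 // oppr_ge0 prjB subr_le0.
have pxy : prj t y = prj t x by move: pw; rewrite prjB; lra.
have oxy : oprj t x < oprj t y by move: ow; rewrite oprjD oprjN; lra.
have yq : (y : R[i]) = q t.
  have [//|h] := polygon_lex t (oner_neq0 R) Dy; exfalso.
  have qD : D (q t) := proj1 (vtx_extreme t (oner_neq0 R)).
  have := lt_ _ qD; have := polygon_halfplane t (oner_neq0 R) Dx; rewrite -/(q t) => h1 h2.
  move: h; rewrite /lexpos prjB oprjD oprjN mul1r -/(q t) => -[|[h3 h4]]; first lra.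
  by apply: (@not_extreme_between t x y (q t)) => //; lra.
have xp : (x : R[i]) = p t.
  have [//|h] := polygon_lex t m1 Dx; exfalso.
  have pD : D (p t) := proj1 (vtx_extreme t m1).
  have := lt_ _ pD; have := polygon_halfplane t m1 Dx; rewrite -/(p t) => h1 h2.
  move: h; rewrite /lexpos prjB oprjD oprjN mulN1r -/(p t) => -[|[h3 h4]]; first lra.
  by apply: (@not_extreme_between t (p t) x y) => //; lra.
exists t; split => //; last by rewrite /side -xp -yq.
by rewrite -xp -yq; apply/eqP.
Qed.

(** For a side vector [w] perpendicular to [cis t], [oprj t w] is its length, so [cis t] can be read
    off from [w]. For a degenerate polygon the two orientations keep the opposite normals apart. *)
Lemma side_inj : {in [seq t <- ts | p t != q t] &, injective side}.
Proof.
move=> t t'; rewrite !mem_filter => /andP[pq tts] /andP[pq' t'ts] [ep eq].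
apply: cis_inj; [exact: ts_bounds|exact: ts_bounds|].
have := prj_qp t; have := oprj_qp pq; have := prj_qp t'; have := oprj_qp pq'.
rewrite -ep -eq; move: (q t - p t) => w o1 p1 o2 p2.
have oo : oprj t w = oprj t' w.
  have := prj_sqr t w; rewrite -(prj_sqr t' w) p1 p2 !expr0n !add0r => /eqP.
  by rewrite eqrXn2 ?ltW // => /eqP.
have n0 : normc w != 0.
  by rewrite normc_eq0; apply: contraTneq o1 => ->; rewrite /oprj /= !mul0r subrr ltxx.
have w2 : oprj t w != 0 by rewrite gt_eqF.
have rot (u : R) : prj u w = 0 -> cos u * oprj u w = Im w /\ sin u * oprj u w = - Re w.
  rewrite /prj /oprj => h; have c2 := cos2Dsin2 u.
  split.
    transitivity (Im w * (cos u ^+ 2 + sin u ^+ 2) - sin u * (Re w * cos u + Im w * sin u)).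
      by ring.
    by rewrite h c2; ring.
  transitivity (- Re w * (cos u ^+ 2 + sin u ^+ 2) + cos u * (Re w * cos u + Im w * sin u)).
    by ring.
  by rewrite h c2; ring.
have [c1 s1] := rot t p2; have [c2 s2] := rot t' p1.
by apply: eqC => /=; apply: (mulIf w2); rewrite ?c1 ?s1 oo ?c2 ?s2.
Qed.

Lemma perimeter_newton_polygon :
  perimeter (newton_polygon L) = \sum_(t <- ts) normc (vtx L 1 t - vtx L (-1) t).
Proof.
rewrite /perimeter.
have -> : oriented_sides (newton_polygon L) =
    [set` [seq side t | t <- [seq t <- ts | p t != q t]]].
  apply/seteqP; split => e /=.
    move=> /oriented_sidesE [t [tts pq ->]]; apply/mapP; exists t => //.
    by rewrite mem_filter pq.
  move=> /mapP [t]; rewrite mem_filter => /andP[pq tts] ->.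
  by apply/oriented_sidesE; exists t.
rewrite -fsbig_seq; last by rewrite map_inj_in_uniq ?filter_uniq //; exact: side_inj.
rewrite big_map big_filter big_mkcond /=; apply: eq_bigr => t _.
(* A candidate direction normal to no side has [p t = q t] and adds nothing. *)
case: ifPn => // /negPn/eqP pq.
by rewrite -/(p t) -/(q t) pq subrr Normc.normc0.
Qed.

End Perimeter.

(** * From cut discs to discs *)

Section ZeroCount.
Variable R : realType.
Local Notation normc := (@Normc.normc R).

Lemma exists_avoiding (s : seq R) (a b : R) : a < b -> exists2 x, a < x < b & x \notin s.
Proof.
elim: s a b => [|y s IH] a b ab.
  by exists ((a + b) / 2) => //; apply/andP; split; lra.
have [ym|my] := leP y ((a + b) / 2).
  have [|x /andP[x1 x2] xs] := IH ((a + b) / 2) b; first lra.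
  exists x; first by rewrite x2 andbT; lra.
  by rewrite in_cons negb_or xs andbT gt_eqF // (le_lt_trans ym).
have [|x /andP[x1 x2] xs] := IH a ((a + b) / 2); first lra.
exists x; first by rewrite x1 /=; lra.
by rewrite in_cons negb_or xs andbT lt_eqF // (lt_trans x2).
Qed.

Lemma leq_sum_subset (T : eqType) (s s' : seq T) (F : T -> nat) : uniq s -> uniq s' ->
  {subset s <= s'} -> (\sum_(i <- s) F i <= \sum_(i <- s') F i)%N.
Proof.
move=> us us' sub.
have pe : perm_eq s [seq x <- s' | x \in s].
  apply: uniq_perm; rewrite ?filter_uniq // => x; rewrite mem_filter.
  by case: (boolP (x \in s)) => // /sub ->.
rewrite (perm_big _ pe) big_filter big_mkcond /=; apply: leq_sum => i _; by case: ifP.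
Qed.

Variables (L : {fset R[i]}) (c : R[i] -> R[i]).
Hypothesis L_neq0 : L != fset0.
Hypothesis c_neq0 : forall l, l \in L -> c l != 0.
Local Notation f := (expsum L c).
Local Notation ordf := (ord L_neq0 c_neq0).

Lemma zero_count_seq (r : R) (zs : seq R[i]) : uniq zs ->
  (forall z, (z \in zs) = (normc z <= r) && (f z == 0)) ->
  zero_count f r = ((\sum_(z <- zs) ordf z)%:R)%:E.
Proof.
move=> uzs zsP; rewrite /zero_count.
have -> : [set z : R[i] | `|z| <= r%:C /\ f z = 0] = [set` zs].
  apply/seteqP; split => z /=; rewrite norm_realC lecR zsP.
    by move=> [-> ->]; rewrite eqxx.
  by move=> /andP[-> /eqP ->].
rewrite esum_fset; last 2 first.
- exact: finite_seq.
- by move=> z _; rewrite (vanishing_order_expsum L_neq0 c_neq0) lee_fin ler0n.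
rewrite -fsbig_seq // natr_sum -sumEFin; apply: eq_bigr => z _.
exact: vanishing_order_expsum.
Qed.

(** A zero [z] lies on the boundary only if [rho = normc z] or [rho ^+ 2 = prj t z ^+ 2 + W ^+ 2],
    which excludes finitely many radii. *)
Lemma exists_zero_free_radius (ts : seq R) (W a : R) : 0 < W -> W <= a ->
  exists2 rho, a < rho < a + 1 &
    forall z, cut_circle ts rho (Num.sqrt (rho ^+ 2 - W ^+ 2)) z -> f z != 0.
Proof.
move=> W0 Wa; have [zs _ zsP] := finite_zeros L_neq0 c_neq0 (a + 1).
pose bad := [seq normc z | z <- zs] ++
  [seq Num.sqrt (prj t z ^+ 2 + W ^+ 2) | t <- ts, z <- zs].
have [|rho /andP[ar ra] rbad] := @exists_avoiding bad a (a + 1); first lra.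
exists rho; first by rewrite ar.
move=> z [[zr _] bz]; apply/negP => /eqP fz; move: rbad; apply/negP; rewrite negbK.
have zzs : z \in zs by rewrite zsP fz eqxx andbT (le_trans zr) // ltW.
rewrite mem_cat; case: bz => [<-|[t tts tz]].
  by apply/orP; left; apply: map_f.
apply/orP; right; apply/allpairsP; exists (t, z); split => //=.
rewrite tz sqr_sqrtr ?subrK; last by rewrite subr_ge0 lerXn2r ?nnegrE; lra.
by rewrite sqrtr_sqr ger0_norm //; lra.
Qed.

End ZeroCount.

Theorem theorem4p1 (R : realType) (L : {fset R[i]}) (c : R[i] -> R[i])
  (L_neq0 : L != fset0) (c_neq0 : forall l, l \in L -> c l != 0) :
  exists C : R, \forall r \near +oo,
    (`| zero_count (expsum L c) r -
        (r / pi * semiperimeter (newton_polygon L))%:E | <= C%:E)%E.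
Proof.
have [ts [W [C [rho0 [ts_path ts_last ties W0 H]]]]] := count_zeros_cut_disc L_neq0 c_neq0.
have ts_uniq : uniq ts.
  by apply: (sorted_uniq lt_trans ltxx); exact: path_sorted ts_path.
have ts_bounds t : t \in ts -> - pi < t <= pi.
  exact: (angles_bounds ts_path ts_last).
have perE := perimeter_newton_polygon L_neq0 ts_uniq ts_bounds ties.
set P := perimeter _ in perE; rewrite -perE in H.
have P0 : 0 <= P by rewrite perE; apply: sumr_ge0 => t _; exact: normc_ge0.
have p0 := pi_gt0 R.
have good (a : R) : W <= a -> rho0 <= a -> exists rho, exists zs : seq R[i],
  [/\ a < rho < a + 1, uniq zs,
      forall z, z \in zs <-> cut_disc ts rho (Num.sqrt (rho ^+ 2 - W ^+ 2)) z /\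
        expsum L c z = 0,
      rho - W <= Num.sqrt (rho ^+ 2 - W ^+ 2) &
      `|(\sum_(z <- zs) ord L_neq0 c_neq0 z)%:R * (pi *+ 2) - rho * P| <= C].
  move=> Wa ra; have [rho rhoa fn0] := exists_zero_free_radius L_neq0 c_neq0 ts W0 Wa.
  have [|h1 h2 h3] := H rho; first by case/andP: rhoa; lra.
  have [zs uzs zsP] := finite_zeros L_neq0 c_neq0 rho.
  pose K := cut_disc ts rho (Num.sqrt (rho ^+ 2 - W ^+ 2)).
  have zsK z : z \in [seq z <- zs | `[< K z >]] <-> K z /\ expsum L c z = 0.
    rewrite mem_filter zsP; split => [/and3P[/asboolP Kz _ /eqP //]|[Kz fz]].
    by apply/and3P; split; [exact/asboolP|case: Kz|exact/eqP].
  exists rho, [seq z <- zs | `[< K z >]]; split; rewrite ?filter_uniq //.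
  by apply: h3; rewrite ?filter_uniq.
(* The radii used differ from [r] by at most [W + 1], an error of [(W + 1) * P] in [rho * P];
   dividing by [pi *+ 2] turns change of argument into a count. *)
exists (((W + 1) * P + C) / (pi *+ 2)).
near=> r.
have [zs uzs zsP] := finite_zeros L_neq0 c_neq0 r.
rewrite (zero_count_seq L_neq0 c_neq0 uzs zsP) -EFinB lee_fin.
set N := (\sum_(z <- zs) _)%N.
have rW : W + 1 <= r by near: r; apply: nbhs_pinfty_ge; exact: num_real.
have rr : rho0 + 1 <= r by near: r; apply: nbhs_pinfty_ge; exact: num_real.
(* A cut disc contains the disc of radius [rho - W], so [rho1 > r + W] gives an upper count;
   [rho2 < r] gives a lower one. *)
have [||rho1 [zs1 [/andP[b1 b2] u1 zs1P s1 e1]]] := good (r + W); [lra|lra|].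
have [||rho2 [zs2 [/andP[b3 b4] u2 zs2P s2 e2]]] := good (r - 1); [lra|lra|].
have up : (N <= \sum_(z <- zs1) ord L_neq0 c_neq0 z)%N.
  apply: leq_sum_subset => // z; rewrite zsP => /andP[zr /eqP fz]; apply/zs1P; split => //.
  split; first lra.
  by move=> t _; apply: le_trans (ler_norm _) _; apply: le_trans (prj_le_normc _ _) _; lra.
have low : (\sum_(z <- zs2) ord L_neq0 c_neq0 z <= N)%N.
  apply: leq_sum_subset => // z /zs2P [[zr _] fz]; rewrite zsP fz eqxx andbT; lra.
rewrite -(ler_nat R) in up; rewrite -(ler_nat R) in low.
move: e1 e2 up low; set N1 := (\sum_(z <- zs1) _)%:R; set N2 := (\sum_(z <- zs2) _)%:R.
move: (N%:R) => x e1 e2 up low.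
rewrite /semiperimeter -/P ler_pdivlMr; last by rewrite mulr2n addr_gt0.
have pp : 0 < pi *+ 2 :> R by rewrite mulr2n addr_gt0.
rewrite -[X in _ * X]gtr0_norm // -normrM.
have -> : (x - r / pi * (P / 2)) * (pi *+ 2) = x * (pi *+ 2) - r * P.
  move: p0; move: (pi : R) => u u0; rewrite mulr2n; field.
  exact: lt0r_neq0.
have up' : x * (pi *+ 2) <= N1 * (pi *+ 2) by rewrite ler_pM2r.
have low' : N2 * (pi *+ 2) <= x * (pi *+ 2) by rewrite ler_pM2r.
have h1 : rho1 * P <= (r + W + 1) * P by rewrite ler_wpM2r //; lra.
have h2 : (r - 1) * P <= rho2 * P by rewrite ler_wpM2r //; lra.
have h3 : 0 <= W * P by rewrite mulr_ge0 // ltW.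
move: e1 e2; rewrite !ler_norml => /andP[e1 e1'] /andP[e2 e2'].
by apply/andP; split; lra.
Unshelve. all: by end_near. Qed.
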